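(* Let $P$ be a simplicial poset and $K$ a field. Let ${}^*\!D_S^\bullet$ be the minimal injective resolution of $S(-\mathbf w)$ in ${}^*\mathrm{Mod}\,S$, placed in cohomological degrees $-N,\dots,0$, and write $${}^*\!D_S^{-i}=\bigoplus_{\substack{\mathfrak p:\ \mathbb Z^n\text{-graded prime of }S\\ \operatorname{ht}\mathfrak p=N-i}}\big({}^*\!E_S(S/\mathfrak p)\big)(-\mathbf a_{\mathfrak p})$$ for some $\mathbf a_{\mathfrak p}\in\mathbb Z^n$. Then one can take $\mathbf a_{\mathfrak p_x}=\mathbf 0$ for all $x\in P$.
   Context: A simplicial poset is a finite poset $P$ with least element $\hat 0$ such that $\{y\in P\mid y\le x\}$ is isomorphic to a boolean algebra for every $x\in P$; $\operatorname{rank} x$ is the rank of this boolean algebra. Put $P^*=P\setminus\{\hat 0\}$. For $x,y\in P$, $[x\vee y]$ is the set of minimal elements of $\{z\in P\mid z\ge x,y\}$. If $[x\vee y]\neq\emptyset$, then $\{z\mid z\le x,\ z\le y\}$ has a greatest element $x\wedge y$. Let $S=K[t_x\mid x\in P^*]$ be the polynomial ring over the field $K$, set $t_{\hat 0}=1$, and for $x,y\in P^*$ let $f_{x,y}=t_xt_y-t_{x\wedge y}\sum_{z\in[x\vee y]}t_z$ (interpreted as $t_xt_y$ if $[x\vee y]=\emptyset$). Let $I_P=(f_{x,y}\mid x,y\in P^* )\subset S$. Let $y_1,\dots,y_n$ be the rank 1 elements of $P$. $S$ is $\mathbb{Z}^n$-graded by $\deg t_x=\sum_{y_i\le x}\mathbf{e}_i$,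 where $\mathbf e_i$ is the $i$-th coordinate vector. ${}^*\mathrm{Mod}\,S$ is the category of $\mathbb{Z}^n$-graded $S$-modules and degree-preserving $S$-homomorphisms; $M(\mathbf a)$ is the shift $M(\mathbf a)_{\mathbf b}=M_{\mathbf a+\mathbf b}$; ${}^*\!E_S(S/\mathfrak p)$ is the injective envelope of $S/\mathfrak p$ in ${}^*\mathrm{Mod}\,S$. For $x\in P$, $\mathfrak{p}_x=(t_z\mid z\in P^*, z\not\le x)+I_P$; this is a $\mathbb Z^n$-graded prime ideal, and every $\mathbb Z^n$-graded prime containing $I_P$ is of this form. $N=\#P^*=\dim S$ and $\mathbf w=\sum_{x\in P^*}\deg t_x\in\mathbb N^n$. The complex ${}^*\!D_S^\bullet$ satisfies $H^{-N}({}^*\!D_S^\bullet)\cong S(-\mathbf w)$ and $H^i({}^*\!D_S^\bullet)=0$ for $i\ne -N$, and is the normalized $\mathbb Z^n$-graded dualizing complex of $S$. The shift $\mathbf a_{\mathfrak p}$ is not uniquely determined in general (different shifts of ${}^*\!E_S(S/\mathfrak p)$ may be isomorphic), and ''one can take $\mathbf a_{\mathfrak p_x}=\mathbf 0$'' means that the summand ${}^*\!E_S(S/\mathfrak p_x)(-\mathbf a_{\mathfrak p_x})$ is isomorphic in ${}^*\mathrm{Mod}\,S$ to ${}^*\!E_S(S/\mathfrak p_x)$. *)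

(* Defs.v *)
From HB Require Import structures.
From mathcomp Require Import all_boot all_order all_algebra ring_quotient.
From mathcomp Require Import mpoly.

Set Implicit Arguments.
Unset Strict Implicit.
Unset Printing Implicit Defensive.

Import Order.Theory GRing.Theory.
Local Open Scope ring_scope.
Local Open Scope quotient_scope.

(* [has_rank x k]: the lower set of x is isomorphic, as a poset, to the boolean
   algebra of subsets of a k-element set. *)
Definition has_rank d (P : finBPOrderType d) (x : P) (k : nat) : bool :=
  [exists f : {ffun {set 'I_k} -> P},
     [forall A, forall B, (f A <= f B)%O == (A \subset B)] &&
     [forall y, (y \in codom f) == (y <= x)%O]].

Definition simplicial d (P : finBPOrderType d) : Prop :=
  forall x : P, exists k, has_rank x k.

Definition pstar d (P : finBPOrderType d) := {x : P | x != \bot%O}.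

Definition vertex d (P : finBPOrderType d) := {y : P | has_rank y 1}.

(* Z^n, with coordinates indexed by the rank 1 elements y_1, ..., y_n
   themselves. *)
Definition Zn d (P : finBPOrderType d) := {ffun vertex P -> int}.
HB.instance Definition _ d (P : finBPOrderType d) := GRing.Zmodule.on (Zn P).

Definition joins d (P : finBPOrderType d) (x y : P) : {set P} :=
  [set z | [&& (x <= z)%O, (y <= z)%O &
     [forall u : P, [&& (x <= u)%O, (y <= u)%O & (u <= z)%O] ==> (u == z)]]].

(* The greatest common lower bound when there is one; otherwise \bot, a value
   which is never used, as [joins x y] is then empty. *)
Definition pmeet d (P : finBPOrderType d) (x y : P) : P :=
  odflt \bot%O [pick z | [forall u : P, (u <= z)%O == (u <= x)%O && (u <= y)%O]].

Section PolynomialRing.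
Context {d : Order.disp_t} (P : finBPOrderType d) (K : fieldType).

Definition nvars : nat := #|{: pstar P}|.

Local Notation polyring := {mpoly K[nvars]}.

(* t_x, with t_\bot = 1. *)
Definition tvar (x : P) : polyring :=
  if insub x is Some z then 'X_(enum_rank (z : pstar P)) else 1.

Definition degt (x : P) : Zn P := [ffun y : vertex P => ((val y <= x)%O : nat)%:Z].

Definition weight : Zn P := \sum_(x : pstar P) degt (val x).

Definition mondeg (m : 'X_{1..nvars}) : Zn P :=
  \sum_(i < nvars) degt (val (enum_val i)) *+ m i.

Definition phomog (a : Zn P) (f : polyring) : Prop :=
  forall m, m \in msupp f -> mondeg m = a.

Definition frel_poly (x y : pstar P) : polyring :=
  tvar (val x) * tvar (val y)
  - tvar (pmeet (val x) (val y)) * \sum_(z in joins (val x) (val y)) tvar z.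

Definition ideal_gen (G : polyring -> Prop) (f : polyring) : Prop :=
  exists (k : nat) (c g : 'I_k -> polyring),
    (forall j, G (g j)) /\ f = \sum_(j < k) c j * g j.

(* The ideal I_P. *)
Definition sp_ideal : polyring -> Prop :=
  ideal_gen (fun f => exists x y : pstar P, f = frel_poly x y).

(* The ideal p_x = (t_z | z not below x) + I_P. *)
Definition sp_prime (x : P) (f : polyring) : Prop :=
  exists g h : polyring,
    [/\ ideal_gen (fun f' => exists2 z : pstar P,
                     ~~ (val z <= x)%O & f' = tvar (val z)) g,
        sp_ideal h & f = g + h].

End PolynomialRing.

(* The subsets A i (to be thought of as subgroups) span M, and the sum of the
   A i is direct. *)
Definition internal_direct_sum (I : Type) (M : zmodType) (A : I -> M -> Prop) :=
  (forall m : M, exists (k : nat) (c : 'I_k -> I) (f : 'I_k -> M),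
     (forall j, A (c j) (f j)) /\ m = \sum_(j < k) f j) /\
  (forall (k : nat) (c : 'I_k -> I) (f : 'I_k -> M),
     injective c -> (forall j, A (c j) (f j)) ->
     \sum_(j < k) f j = 0 -> forall j, f j = 0).

Record gmod d (P : finBPOrderType d) (K : fieldType) := GMod {
  gcarrier :> lmodType {mpoly K[nvars P]};
  gpart : Zn P -> gcarrier -> Prop;
  gpart0 : forall a, gpart a 0;
  gpartB : forall a u v, gpart a u -> gpart a v -> gpart a (u - v);
  gpartZ : forall a b s u, phomog a s -> gpart b u -> gpart (a + b) (s *: u);
  gpart_sum : internal_direct_sum gpart }.

Arguments gpart {d P K} g _ _.

Section GradedModules.
Context {d : Order.disp_t} {P : finBPOrderType d} {K : fieldType}.
Local Notation S := {mpoly K[nvars P]}.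
Local Notation gmod := (gmod P K).

Record ghom (M N : gmod) := GHom {
  gfun :> {linear M -> N};
  gfun_deg : forall a u, gpart M a u -> gpart N a (gfun u) }.

Definition giso (M N : gmod) : Prop :=
  exists (f : ghom M N) (g : ghom N M), cancel f g /\ cancel g f.

(* M(a), with M(a)_b = M_(a+b). *)
Section Shift.
Variables (M : gmod) (a : Zn P).

Definition shift_part (b : Zn P) (u : M) : Prop := gpart M (a + b) u.

Lemma shift_partZ b c s u :
  phomog b s -> shift_part c u -> shift_part (b + c) (s *: u).
Proof. by move=> hs hu; rewrite /shift_part addrCA; exact: gpartZ. Qed.

Lemma shift_part_sum : internal_direct_sum shift_part.
Proof.
have [hspan hind] := gpart_sum M; split.
  move=> m; have [k [c [f [hf ->]]]] := hspan m.
  exists k, (fun j => c j - a), f; split=> // j.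
  by rewrite /shift_part addrC subrK.
move=> k c f cI hf; apply: (hind k (fun j => a + c j)) => //.
by move=> i j /addrI /cI.
Qed.

Definition shift : gmod :=
  @GMod d P K M shift_part (fun b => gpart0 M (a + b))
    (fun b u v => @gpartB _ _ _ M (a + b) u v) shift_partZ shift_part_sum.

End Shift.

Lemma phomog0 a : phomog a (0 : S).
Proof. by move=> m; rewrite msupp0. Qed.

Lemma phomogB a (f g : S) : phomog a f -> phomog a g -> phomog a (f - g).
Proof.
move=> hf hg m /msuppB_le; rewrite mem_cat => /orP[]; [exact: hf|exact: hg].
Qed.

Lemma mondegD (m1 m2 : 'X_{1..nvars P}) :
  mondeg (m1 + m2)%MM = mondeg m1 + mondeg m2.
Proof.
by rewrite /mondeg -big_split; apply: eq_bigr => i _; rewrite mnmDE mulrnDr.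
Qed.

Lemma phomogM a b (f g : S) : phomog a f -> phomog b g -> phomog (a + b) (f * g).
Proof.
move=> hf hg m /msuppM_le /allpairsP[[m1 m2] /= [h1 h2 ->]].
by rewrite mondegD (hf _ h1) (hg _ h2).
Qed.

Lemma phomog_span (f : S) : exists (k : nat) (c : 'I_k -> Zn P) (g : 'I_k -> S),
  (forall j, phomog (c j) (g j)) /\ f = \sum_(j < k) g j.
Proof.
pose s := msupp f.
exists (size s), (fun j => mondeg (nth 0%MM s j)),
  (fun j => (f@_(nth 0%MM s j) *: 'X_[nth 0%MM s j])%R); split.
  by move=> j m /msuppZ_le; rewrite msuppX inE => /eqP->.
rewrite {1}[f]mpolyE (big_nth 0%MM) big_mkord; exact: eq_bigr.
Qed.

Lemma phomog_coeff a (f : S) m : phomog a f -> mondeg m != a -> f@_m = 0.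
Proof.
by move=> hf ne; apply/memN_msupp_eq0/negP => /hf e; rewrite e eqxx in ne.
Qed.

Lemma phomog_sum : internal_direct_sum (M := S) (@phomog d P K).
Proof.
split=> [|k c f cI hf s0 j]; first exact: phomog_span.
apply/mpolyP => m; rewrite mcoeff0.
have [e|ne] := eqVneq (mondeg m) (c j); last exact: phomog_coeff (hf j) ne.
have := congr1 (mcoeff m) s0; rewrite mcoeff0 raddf_sum (bigD1 j) //= big1.
  by rewrite addr0.
move=> i ij; apply: phomog_coeff (hf i) _.
by rewrite e; apply: contra ij => /eqP/cI->.
Qed.

(* S as a graded module over itself. *)
Definition greg : gmod :=
  @GMod d P K (S^o) (@phomog d P K) phomog0 phomogB phomogM phomog_sum.

Definition submodule (M : gmod) (U : M -> Prop) : Prop :=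
  U 0 /\ forall (s : S) u v, U u -> U v -> U (s *: u + v).

Definition graded_submodule (M : gmod) (U : M -> Prop) : Prop :=
  submodule U /\
  forall u, U u -> exists (k : nat) (c : 'I_k -> Zn P) (f : 'I_k -> M),
    (forall j, gpart M (c j) (f j) /\ U (f j)) /\ u = \sum_(j < k) f j.

Record gprime := GPrime {
  gprime_ideal :> prime_idealr S;
  gprime_graded : graded_submodule (M := greg) (fun f => f \in (gprime_ideal : {pred S})) }.

Section QuotientModule.
Variable p : gprime.
Local Notation I := (gprime_ideal p).

Definition squot := {ideal_quot I}.
HB.instance Definition _ := GRing.Zmodule.on squot.

Definition squot_scale (s : S) (u : squot) : squot :=
  (\pi_({ideal_quot I}) s : {ideal_quot I}) * (u : {ideal_quot I}).

Fact squot_scaleA s t u :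
  squot_scale s (squot_scale t u) = squot_scale (s * t) u.
Proof. by rewrite /squot_scale rmorphM mulrA. Qed.
Fact squot_scale1 : left_id 1 squot_scale.
Proof. by move=> u; rewrite /squot_scale rmorph1 mul1r. Qed.
Fact squot_scaleDr : right_distributive squot_scale +%R.
Proof. by move=> s u v; exact: mulrDr. Qed.
Fact squot_scaleDl u : {morph squot_scale^~ u : s t / s + t}.
Proof. by move=> s t; rewrite /squot_scale rmorphD; exact: mulrDl. Qed.

HB.instance Definition _ := GRing.Zmodule_isLmodule.Build S squot
  squot_scaleA squot_scale1 squot_scaleDr squot_scaleDl.

Definition squot_part (a : Zn P) (u : squot) : Prop :=
  exists2 f : S, phomog a f & u = \pi_({ideal_quot I}) f.

Lemma squot_part0 a : squot_part a 0.
Proof. by exists 0; [exact: phomog0 | rewrite rmorph0]. Qed.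

Lemma squot_partB a u v : squot_part a u -> squot_part a v -> squot_part a (u - v).
Proof.
move=> [f hf ->] [g hg ->]; exists (f - g); first exact: phomogB.
by rewrite rmorphB.
Qed.

Lemma squot_partZ a b s u :
  phomog a s -> squot_part b u -> squot_part (a + b) (s *: u).
Proof.
move=> hs [f hf ->]; exists (s * f); first exact: phomogM.
by rewrite rmorphM.
Qed.

Lemma squot_pi0 (f : S) :
  \pi_({ideal_quot I}) f = 0 <-> f \in (I : {pred S}).
Proof.
rewrite -[f in f \in _]subr0 Quotient.idealrBE -(rmorph0 (\pi_({ideal_quot I}))).
by split=> [->|/eqP].
Qed.

Lemma squot_part_sum : internal_direct_sum (M := squot) squot_part.
Proof.
split=> [u|k c u cI hu s0 j].
  have [k [c [f [hf e]]]] := phomog_span (repr u : S).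
  exists k, c, (fun j => \pi_({ideal_quot I}) (f j)); split.
    by move=> j; exists (f j).
  by rewrite -[u]reprK e rmorph_sum.
have [f hf] := fin_all_exists2 hu.
move=> uE; have fI : \sum_(i < k) f i \in (I : {pred S}).
  apply/squot_pi0; rewrite rmorph_sum -[RHS]s0.
  by apply: eq_bigr => i _; rewrite uE.
have [_ /(_ _ fI)[l [b [g [hg fg]]]]] := gprime_graded p.
rewrite uE; apply/squot_pi0.
suff -> : f j = \sum_(i < l | b i == c j) g i.
  by apply: rpred_sum => i _; case: (hg i).
apply/mpolyP => m.
have [e|ne] := eqVneq (mondeg m) (c j); last first.
  rewrite (phomog_coeff (hf j) ne) raddf_sum big1 // => i /eqP bi.
  by apply: phomog_coeff (hg i).1 _; rewrite bi.
have := congr1 (mcoeff m) fg; rewrite !raddf_sum (bigD1 j) //= [X in _ + X]big1.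
  rewrite addr0 => ->; rewrite [RHS]big_mkcond; apply: eq_bigr => i _.
  case: eqP => // /eqP ne; apply: phomog_coeff (hg i).1 _.
  by rewrite e eq_sym.
move=> i ij; apply: phomog_coeff (hf i) _.
by rewrite e; apply: contra ij => /eqP/cI->.
Qed.

Definition gquot : gmod :=
  @GMod d P K squot squot_part squot_part0 squot_partB squot_partZ squot_part_sum.

End QuotientModule.

Definition is_direct_sum (I : Type) (F : I -> gmod) (M : gmod) : Prop :=
  exists u : forall i, ghom (F i) M,
    (forall i, injective (u i)) /\
    internal_direct_sum (fun i (m : M) => exists v : F i, u i v = m).

Definition injective_object (E : gmod) : Prop :=
  forall (A B : gmod) (i : ghom A B) (f : ghom A E), injective i ->
  exists g : ghom B E, forall u, g (i u) = f u.

(* U is an essential subset of M in the category of graded modules; used for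
   graded submodules U. *)
Definition essential (M : gmod) (U : M -> Prop) : Prop :=
  forall V : M -> Prop, graded_submodule V ->
  (exists2 v, V v & v <> 0) -> exists v, [/\ V v, U v & v <> 0].

Definition injective_envelope (M E : gmod) (u : ghom M E) : Prop :=
  [/\ injective_object E, injective u & essential (fun e => exists m, u m = e)].

(* D, together with the augmentation u, is the minimal injective resolution
   0 -> M -> D^{-N} -> ... -> D^0 -> 0.  Minimality: each D^j is an essential
   extension (hence an injective envelope) of the kernel of D^j -> D^{j+1}. *)
Definition minimal_injective_resolution (N : nat) (M : gmod) (D : int -> gmod)
    (diff : forall j, ghom (D j) (D (j + 1))) (u : ghom M (D (- N%:Z))) : Prop :=
  [/\ (forall j, injective_object (D j)),
      (forall j, ~~ (- N%:Z <= j <= 0)%R -> forall v : D j, v = 0),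
      injective u /\ (forall v, diff (- N%:Z) v = 0 <-> exists m, u m = v),
      (forall j, j + 1 != - N%:Z ->
         forall v, diff (j + 1) v = 0 <-> exists v', diff j v' = v)
    & (forall j, essential (fun v => diff j v = 0))].

(* There is a chain of prime ideals of length h, graded or not, with top p. *)
Definition prime_chain_to (p : prime_idealr S) (h : nat) : Prop :=
  exists c : nat -> prime_idealr S,
    (c h : {pred S}) =i (p : {pred S}) /\
    forall j, (j < h)%N ->
      {subset (c j : {pred S}) <= (c j.+1 : {pred S})} /\
      ~ {subset (c j.+1 : {pred S}) <= (c j : {pred S})}.

Definition has_height (p : prime_idealr S) (h : nat) : Prop :=
  prime_chain_to p h /\ forall k, prime_chain_to p k -> (k <= h)%N.

End GradedModules.

Arguments greg {d} P K.
Arguments gprime {d} P K.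

(* Main.v *)
From HB Require Import structures.
Require Import Defs.
From mathcomp Require Import all_boot all_order all_algebra ring_quotient mpoly.
From Stdlib Require Import Classical.

Set Implicit Arguments.
Unset Strict Implicit.
Unset Printing Implicit Defensive.

Import Order.Theory GRing.Theory.
Local Open Scope ring_scope.
Local Open Scope quotient_scope.

(** The idea is to compute the socle-like part of the resolution at p_x by
    cutting down along a regular sequence, one element at a time.

    Substituting t_z := 0 when z is not below x, and t_z := the product of the
    t_y over the vertices y <= z when z <= x, is an endomorphism of S whose
    kernel is p_x ([sp_primeP]; this is where the Boolean intervals of P enter).
    Performing the substitution one variable at a time, over the m variables
    which are not vertices below x, gives graded primes
    0 = J_0 < J_1 < ... < J_m = p_x with J_(k+1) = J_k + (f_k), where
    f_k = t_z - (value substituted for t_z) has degree deg t_z and does not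
    belong to J_k ([elim_primeE], [elim_rel_notin]).

    Write D[J] for the subcomplex of elements killed by J. As each D^j is
    injective, f_k maps D[J_k] onto itself, with kernel D[J_(k+1)]
    ([injective_div]). Following the connecting homomorphism by hand, the
    cocycles of D[J_k] in degree -N+k are, by induction on k, a copy of S/J_k
    generated in degree w - deg f_0 - ... - deg f_(k-1), and D[J_k] is exact
    above that degree ([fundamental_exists]). For k = m the generator has degree
    the sum of the deg t_y over the vertices y <= x, which is the degree of a
    monomial outside p_x.

    The prime p_x has height m ([face_prime_height]), so the summand
    E(S/p_x)(-a) lies in D^(-N+m), and it contains a nonzero element of degree a
    killed by p_x. By minimality some homogeneous multiple of that element is a
    nonzero cocycle, hence a multiple of the generator ([killed_degree]).
    Comparing degrees, a is a difference of degrees of two homogeneous elements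
    outside p_x. Such elements act bijectively on E(S/p_x), and multiplying by one
    and dividing by the other is the required isomorphism ([envelope_shift]). *)

(** * Ideals and substitutions in polynomial rings *)

Section Substitution.
Variable K : fieldType.

(** Ideals as propositional predicates, so that [sp_prime] is one before it is
    known to be decidable. *)
Definition is_ideal (R : nzRingType) (I : R -> Prop) : Prop :=
  I 0 /\ forall s u v, I u -> I v -> I (s * u + v).

Section IdealPred.
Variables (R : comNzRingType) (I : R -> Prop) (idI : is_ideal I).
Lemma is_ideal0 : I 0. Proof. by case: idI. Qed.
Lemma is_idealM s u : I u -> I (s * u).
Proof. by move=> hu; rewrite -[s * u]addr0; apply: idI.2 => //; exact: is_ideal0. Qed.
Lemma is_idealD u v : I u -> I v -> I (u + v).
Proof. by move=> hu; rewrite -[u]mul1r; apply: idI.2. Qed.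
Lemma is_ideal_sum (J : Type) (r : seq J) (Q : pred J) (F : J -> R) :
  (forall j, Q j -> I (F j)) -> I (\sum_(j <- r | Q j) F j).
Proof. by move=> h; apply: big_ind => //; [exact: is_ideal0|exact: is_idealD]. Qed.
End IdealPred.

(** Two ring morphisms that agree modulo an ideal on the generators agree modulo
    it everywhere. It yields extensionality for the zero ideal, divisibility by
    t_z - c for a substitution t_z := c, and the description of p_x. *)
Lemma rmorph_congr n (R : comNzRingType) (I : R -> Prop) (idI : is_ideal I)
    (f g : {rmorphism {mpoly K[n]} -> R}) :
  (forall c, f c%:MP = g c%:MP) -> (forall i, I (f 'X_i - g 'X_i)) ->
  forall p, I (f p - g p).
Proof.
move=> fgC fgX.
have cM u u' v v' : I (u - u') -> I (v - v') -> I (u * v - u' * v').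
  move=> hu hv; rewrite (_ : _ - _ = v * (u - u') + u' * (v - v')).
    by apply: is_idealD; first exact: idI; exact: is_idealM.
  by rewrite !mulrBr [v * u]mulrC [v * u']mulrC addrA subrK.
have c1 : I (1 - 1) by rewrite subrr; exact: is_ideal0.
elim/mpolyind=> [|c m p _ _ IH]; first by rewrite !rmorph0 subr0; exact: is_ideal0.
rewrite !rmorphD opprD addrACA -mul_mpolyC mpolyXE_id !rmorphM !rmorph_prod.
apply: is_idealD => //; rewrite -fgC.
apply: (cM); first by rewrite subrr; exact: is_ideal0.
apply: (big_ind2 (fun x y => I (x - y)) c1 cM) => i _; rewrite !rmorphXn /=.
by elim: (m i) => [|e IHe]; rewrite ?expr0 // !exprS; exact: cM.
Qed.

Lemma is_ideal_eq0 (R : comNzRingType) : is_ideal (fun x : R => x = 0).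
Proof. by split=> // s u v -> ->; rewrite mulr0 addr0. Qed.

Lemma is_ideal_dvd (R : comNzRingType) (h : R) : is_ideal (fun x => exists g, x = h * g).
Proof.
split=> [|s _ _ [g ->] [g' ->]]; first by exists 0; rewrite mulr0.
by exists (s * g + g'); rewrite mulrDr mulrCA.
Qed.

Lemma rmorph_ext n (R : comNzRingType) (f g : {rmorphism {mpoly K[n]} -> R}) :
  (forall c, f c%:MP = g c%:MP) -> (forall i, f 'X_i = g 'X_i) -> f =1 g.
Proof.
move=> hC hX p; apply/eqP; rewrite -subr_eq0; apply/eqP.
by apply: (rmorph_congr (is_ideal_eq0 R)) => // i; rewrite hX subrr.
Qed.

Definition subst n k (h : 'I_n -> {mpoly K[k]}) := comp_mpoly (mktuple h).
HB.instance Definition _ n k (h : 'I_n -> {mpoly K[k]}) :=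
  GRing.RMorphism.copy (subst h) (comp_mpoly (mktuple h)).

Lemma substX n k (h : 'I_n -> {mpoly K[k]}) i : subst h 'X_i = h i.
Proof. by rewrite /subst comp_mpolyXU -tnth_nth tnth_mktuple. Qed.

Lemma substC n k (h : 'I_n -> {mpoly K[k]}) c : subst h c%:MP = c%:MP.
Proof. exact: comp_mpolyC. Qed.

Lemma subst_comp n k l (h : 'I_n -> {mpoly K[k]}) (h' : 'I_k -> {mpoly K[l]}) p :
  subst h' (subst h p) = subst (fun i => subst h' (h i)) p.
Proof.
apply: (rmorph_ext (f := subst h' \o subst h)
  (g := subst (fun i => subst h' (h i)))) => [c|i] /=.
  by rewrite !substC.
by rewrite !substX.
Qed.

Lemma eq_subst n k (h h' : 'I_n -> {mpoly K[k]}) : h =1 h' -> subst h =1 subst h'.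
Proof.
move=> e p; apply: (rmorph_ext (f := subst h) (g := subst h')) => [c|i] /=.
  by rewrite !substC.
by rewrite !substX.
Qed.

Lemma subst_id n (p : {mpoly K[n]}) : subst (fun i => 'X_i) p = p.
Proof. exact: comp_mpoly_id. Qed.

(** * Algebraic dependence and the height of a prime *)

Definition mdeg_le n (p : {mpoly K[n]}) (c : nat) := forall m, m \in msupp p -> (mdeg m <= c)%N.

Lemma mdeg_leM n (p q : {mpoly K[n]}) c c' :
  mdeg_le p c -> mdeg_le q c' -> mdeg_le (p * q) (c + c').
Proof.
move=> hp hq m /msuppM_le /allpairsP[[m1 m2] /= [h1 h2 ->]].
by rewrite mdegD leq_add ?hp ?hq.
Qed.

Lemma mdeg_le1 n : mdeg_le (1 : {mpoly K[n]}) 0.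
Proof. by move=> m; rewrite msupp1 inE => /eqP->; rewrite mdeg0. Qed.

Lemma mdeg_leX n (p : {mpoly K[n]}) c e : mdeg_le p c -> mdeg_le (p ^+ e) (e * c).
Proof.
move=> hp; elim: e => [|e IH]; first by rewrite expr0; exact: mdeg_le1.
by rewrite exprS mulSn; exact: mdeg_leM.
Qed.

Lemma mdeg_le_prod n k (p : 'I_k -> {mpoly K[n]}) (c : 'I_k -> nat) :
  (forall i, mdeg_le (p i) (c i)) -> mdeg_le (\prod_i p i) (\sum_i c i).
Proof.
move=> h; apply: (big_ind2 (fun p c => mdeg_le p c)) => //; first exact: mdeg_le1.
by move=> *; exact: mdeg_leM.
Qed.

(** Dimension count: the products of the g_i with all exponents below D are D^n'
    many, and they lie in the span of the monomials with exponents below a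
    constant times D, of which there are only O(D^n). *)
Lemma alg_dependent n n' (g : 'I_n' -> {mpoly K[n]}) : (n < n')%N ->
  exists2 F : {mpoly K[n']}, F != 0 & subst g F = 0.
Proof.
move=> nn'; pose b := (\max_i msize (g i))%N.
have gb i : mdeg_le (g i) b.
  move=> m /msize_mdeg_lt /ltnW h; apply: leq_trans h _.
  exact: (leq_bigmax (F := fun i => msize (g i)) i).
(* D is just large enough for L^n < D^n' to follow from n < n'. *)
pose D := (((n' * b).+1 ^ n).+1)%N; pose L := ((n' * b).+1 * D)%N.
pose I1 := {ffun 'I_n' -> 'I_D}; pose I2 := {ffun 'I_n -> 'I_L}.
have cI : (#|{: I2}| < #|{: I1}|)%N.
  rewrite !card_ffun !card_ord /L expnMn; apply: (@leq_trans (D * D ^ n)%N).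
    by rewrite ltn_pmul2r // expn_gt0.
  by rewrite -expnS leq_pexp2l.
pose ex1 (i : 'I_#|{: I1}|) : 'X_{1..n'} := [multinom (enum_val i k : nat) | k < n'].
pose G i := subst g 'X_[ex1 i].
have GE i : G i = \prod_k g k ^+ ex1 i k.
  by rewrite /G /subst comp_mpolyX; apply: eq_bigr => k _; rewrite tnth_mktuple.
have Gdeg i m : m \in msupp (G i) -> forall k, (m k < L)%N.
  move=> mG k; have /(_ _ mG) : mdeg_le (G i) (\sum_k ex1 i k * b).
    by rewrite GE; apply: mdeg_le_prod => j; apply: mdeg_leX.
  rewrite mdegE (bigD1 k) //= => /(leq_trans (leq_addr _ _)) => h.
  have h2 : (\sum_k ex1 i k * b <= n' * b * D)%N.
    rewrite -mulnA -[X in (X * _)%N]card_ord -sum_nat_const; apply: leq_sum => j _.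
    by rewrite mulnC leq_mul2l mnmE ltnW ?orbT.
  by rewrite (leq_ltn_trans h) // (leq_ltn_trans h2) // ltn_pmul2r.
pose ex2 (j : 'I_#|{: I2}|) : 'X_{1..n} := [multinom (enum_val j k : nat) | k < n].
pose M : 'M[K]_(#|{: I1}|, #|{: I2}|) := \matrix_(i, j) (G i)@_(ex2 j).
have : kermx M != 0.
  rewrite kermx_eq0; apply/negP => /eqP h; have := rank_leq_col M.
  by rewrite h leqNgt cI.
case/rowV0Pn=> v /sub_kermxP vM v0.
pose F := \sum_i v 0 i *: ('X_[ex1 i] : {mpoly K[n']}); exists F.
  have [i vi] := rV0Pn _ v0; apply: contra vi => /eqP F0.
  have := congr1 (mcoeff (ex1 i)) F0; rewrite mcoeff0 raddf_sum (bigD1 i) //= big1.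
    by rewrite addr0 mcoeffZ mcoeffX eqxx mulr1 => ->.
  move=> j ij; rewrite mcoeffZ mcoeffX; case: eqP => [e|_]; last by rewrite mulr0.
  case/eqP: ij; apply: enum_val_inj; apply/ffunP=> k; apply: val_inj.
  by have := congr1 (fun m : 'X_{1..n'} => m k) e; rewrite /= !mnmE.
have FE : subst g F = \sum_i v 0 i *: G i.
  rewrite /F rmorph_sum /=; apply: eq_bigr => i _.
  by rewrite -!mul_mpolyC rmorphM /= substC.
apply/mpolyP => m; rewrite mcoeff0 FE raddf_sum /=.
have [/forallP mL|] := boolP [forall k, (m k < L)%N].
  pose j : 'I_#|{: I2}| := enum_rank [ffun k => Ordinal (mL k)].
  have mj : m = ex2 j by apply/mnmP=> k; rewrite mnmE enum_rankK ffunE.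
  have := congr1 (fun A : 'rV_ _ => A 0 j) vM; rewrite !mxE => h.
  rewrite -[RHS]h; apply: eq_bigr => i _.
  by rewrite mcoeffZ !mxE -mj.
rewrite negb_forall => /existsP[k mk]; apply: big1 => i _; rewrite mcoeffZ.
rewrite memN_msupp_eq0 ?mulr0 //; apply: contra mk => h; exact: Gdeg h k.
Qed.

Section ChainBound.
Variables (n : nat) (p : prime_idealr {mpoly K[n]}) (A : {set 'I_n}).
Hypothesis pA : forall F : {mpoly K[n]},
  subst (fun i => if i \in A then 'X_i else 0) F = F ->
  F \in (p : {pred _}) -> F = 0.

Let kill_below (k j : nat) : {mpoly K[k]} -> {mpoly K[k]} :=
  subst (fun i : 'I_k => if (i < j)%N then 0 else 'X_i).

(** Induction step of the height bound. Let F be a nonzero relation modulo q that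
    does not involve the variables below j. Since x_j = g j lies in q' but not in
    q, dividing F by the highest power of the j-th variable keeps a relation
    modulo q, and its part free of that variable is then a relation modulo q'. *)
Lemma chain_step k (g : 'I_k -> {mpoly K[n]}) (q q' : prime_idealr {mpoly K[n]}) (j : 'I_k) :
  {subset (q : {pred _}) <= (q' : {pred _})} ->
  g j \in (q' : {pred _}) -> g j \notin (q : {pred _}) ->
  forall F, F != 0 -> kill_below j F = F -> subst g F \in (q : {pred _}) ->
  exists F', [/\ F' != 0, kill_below j.+1 F' = F' & subst g F' \in (q' : {pred _})].
Proof.
move=> qq' gq' gq F; have [w] := ubnP (msize F); elim: w F => // w IH F Fw F0 Fj Fq.
have [G FG] : exists G, kill_below j F - kill_below j.+1 F = 'X_j * G.
  pose tr l : 'I_k -> {mpoly K[k]} := fun i => if (i < l)%N then 0 else 'X_i.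
  apply: (rmorph_congr (is_ideal_dvd ('X_j : {mpoly K[k]}))
    (f := subst (tr j)) (g := subst (tr j.+1))) => [c|i] /=.
    by rewrite !substC.
  rewrite !substX /tr ltnS (leq_eqVlt i); case: (eqVneq (i : nat) j) => [/val_inj->|_] /=.
    by exists 1; rewrite ltnn subr0 mulr1.
  by exists 0; rewrite subrr mulr0.
rewrite Fj in FG.
have kill_belowK k' (F1 : {mpoly K[k]}) : kill_below k' (kill_below k' F1) = kill_below k' F1.
  rewrite /kill_below subst_comp; apply: eq_subst => i; case: ifP => h; rewrite ?rmorph0 //.
  by rewrite substX h.
have [T0|T0] := eqVneq (kill_below j.+1 F) 0.
  rewrite T0 subr0 in FG.
  have G0 : G != 0 by apply: contra F0 => /eqP e; rewrite FG e mulr0.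
  have X0 : ('X_j : {mpoly K[k]}) != 0 by rewrite -msize_poly_eq0 msizeX.
  apply: (IH G).
  - by move: Fw; rewrite FG msizeM // msizeX mdeg1 /= -ltnS.
  - exact: G0.
  - apply: (mulfI X0); rewrite -FG -Fj FG /kill_below rmorphM /= substX ltnn.
    by [].
  have := prime_idealrM q (g j) (subst g G).
  by move: Fq; rewrite FG rmorphM /= substX => -> /esym; rewrite (negPf gq).
exists (kill_below j.+1 F); split=> //.
have -> : kill_below j.+1 F = F - 'X_j * G by rewrite -FG opprB addrC subrK.
rewrite rmorphB rmorphM /= substX rpredB //; first exact: qq'.
by rewrite mulrC idealMr.
Qed.

(** If the variables in A stay algebraically independent modulo p, then p has
    height at most n - #|A|. For a longer chain, elements x_j of the successive
    differences together with the variables in A would be more than n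
    polynomials, hence would satisfy a relation; [chain_step] eliminates the x_j
    one after the other, until a nonzero polynomial in A falls in p. *)
Lemma chain_bound (k : nat) (c : nat -> prime_idealr {mpoly K[n]}) :
  (c k : {pred _}) =i (p : {pred _}) ->
  (forall j, (j < k)%N ->
      {subset (c j : {pred _}) <= (c j.+1 : {pred _})} /\
      ~ {subset (c j.+1 : {pred _}) <= (c j : {pred _})}) ->
  (k + #|A| <= n)%N.
Proof.
move=> ck cs; rewrite leqNgt; apply/negP => nk.
have /fin_all_exists2[x x1 x2] : forall j : 'I_k, exists2 y,
    y \in (c j.+1 : {pred _}) & y \notin (c j : {pred _}).
  move=> j; have [_ ns] := cs j (ltn_ord j).
  have [y hy] := not_all_ex_not _ _ ns.
  by have [y1 /negP y2] := imply_to_and _ _ hy; exists y.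
pose g (i : 'I_(k + #|A|)) : {mpoly K[n]} :=
  match split i with inl j => x j | inr j => 'X_(enum_val j) end.
have [F F0 Fg] := alg_dependent g nk.
have : forall j, (j <= k)%N ->
    exists F', [/\ F' != 0, kill_below j F' = F' & subst g F' \in (c j : {pred _})].
  elim=> [|j IH] jk.
    exists F; split=> //; last by rewrite Fg rpred0.
    by rewrite -[RHS]subst_id; exact: eq_subst.
  have [F' [F'0 F'j F'c]] := IH (ltnW jk).
  have jkA : (j < k + #|A|)%N by rewrite (leq_trans jk) ?leq_addr.
  have gj : g (Ordinal jkA) = x (Ordinal jk).
    rewrite /g; case: splitP => [i /= e|i /= e].
      by congr x; apply: val_inj.
    by have := jk; rewrite {1}e ltnNge leq_addr.
  apply: (@chain_step _ g (c j) (c j.+1) (Ordinal jkA)) F'0 F'j F'c.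
  - by case: (cs j jk).
  - by rewrite gj; exact: x1 (Ordinal jk).
  - by rewrite gj; exact: x2 (Ordinal jk).
case/(_ _ (leqnn k)) => F' [F'0 F'k]; rewrite ck => F'p.
case/eqP: F'0.
pose g' (i : 'I_(k + #|A|)) : {mpoly K[n]} :=
  match split i with inl j => 0 | inr j => 'X_(enum_val j) end.
have gF' : subst g F' = subst g' F'.
  rewrite -F'k /kill_below !subst_comp; apply: eq_subst => i.
  case: ltnP => ik; first by rewrite !rmorph0.
  rewrite !substX /g /g'; case: splitP => // j e.
  by move: ik; rewrite e leqNgt ltn_ord.
have g'0 : subst g' F' = 0.
  apply: pA; last by rewrite -gF'.
  rewrite subst_comp; apply: eq_subst => i; rewrite /g'; case: splitP => j _.
    by rewrite rmorph0.
  by rewrite substX enum_valP.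
pose b (i : 'I_n) : {mpoly K[k + #|A|]} :=
  if [pick j | enum_val j == i] is Some j then 'X_(rshift k j) else 0.
have <- : subst b (subst g' F') = 0 by rewrite g'0 rmorph0.
rewrite -[LHS]F'k /kill_below subst_comp; apply: eq_subst => i /=.
rewrite /g'; case: splitP => j e.
  by rewrite rmorph0.
rewrite substX /b /=; case: pickP => [l /eqP/enum_val_inj->|/(_ j)].
  by congr 'X_ _; apply: val_inj.
by rewrite eqxx.
Qed.

End ChainBound.
End Substitution.

(** * Successive kernels of a substitution *)

Section KernelPrime.
Variables (R R' : idomainType) (f : {rmorphism R -> R'}).

Definition kernel : pred R := fun p => f p == 0.

Fact kernel_idealr_closed : idealr_closed kernel.
Proof.
split; first by rewrite unfold_in rmorph0.
  by rewrite unfold_in rmorph1 oner_eq0.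
move=> a u v; rewrite !unfold_in => /eqP hu /eqP hv.
by rewrite rmorphD rmorphM hu hv mulr0 addr0.
Qed.

Fact kernel_prime_closed : prime_idealr_closed kernel.
Proof. by move=> u v; rewrite !unfold_in rmorphM mulf_eq0. Qed.

HB.instance Definition _ := isIdealr.Build R kernel kernel_idealr_closed.
HB.instance Definition _ := isPrimeIdealrClosed.Build R kernel kernel_prime_closed.

Definition kernel_prime : prime_idealr R := kernel.

Lemma kernelP p : reflect (f p = 0) (p \in (kernel_prime : {pred R})).
Proof. exact: eqP. Qed.
End KernelPrime.

(** The values [h i] substituted for the variables listed in [e] involve only the
    other variables; [h_fixed] expresses this without mentioning supports. *)
Section PartialSubstitution.
Variables (K : fieldType) (n : nat) (h : 'I_n -> {mpoly K[n]}) (e : seq 'I_n).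
Hypothesis e_uniq : uniq e.
Hypothesis h_fixed : forall h' : 'I_n -> {mpoly K[n]},
  (forall i, i \notin e -> h' i = 'X_i) ->
  forall i, i \in e -> subst h' (h i) = h i.

Definition partial_subst (k : nat) : 'I_n -> {mpoly K[n]} :=
  fun i => if i \in take k e then h i else 'X_i.

Lemma partial_subst0 p : subst (partial_subst 0) p = p.
Proof. by rewrite -[RHS]subst_id; apply: eq_subst => i; rewrite /partial_subst take0. Qed.

Lemma partial_subst_idem k p :
  subst (partial_subst k) (subst (partial_subst k) p) = subst (partial_subst k) p.
Proof.
rewrite subst_comp; apply: eq_subst => i; rewrite {2 3}/partial_subst /=.
case: ifP => ik; last by rewrite substX /partial_subst ik.
apply: h_fixed; last exact: (mem_take ik).
by move=> j je; rewrite /partial_subst ifN //; apply: contra je; exact: mem_take.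
Qed.

Variables (k : nat) (i0 : 'I_n).
Hypothesis ke : (k < size e)%N.
Local Notation ek := (nth i0 e k).

Definition subst_rel : {mpoly K[n]} := 'X_ek - h ek.

Lemma ek_notin_take : ek \notin take k e.
Proof.
have : uniq (take k e ++ drop k e) by rewrite cat_take_drop.
by rewrite (drop_nth i0 ke) cat_uniq /= => /and3P[_ /norP[]].
Qed.

Lemma partial_subst_rel : subst (partial_subst k) subst_rel = subst_rel.
Proof.
rewrite rmorphB /= substX /partial_subst (negPf ek_notin_take); congr (_ - _).
apply: h_fixed; last exact: mem_nth.
by move=> j je; rewrite ifN //; apply: contra je; exact: mem_take.
Qed.

Lemma subst_rel_neq0 : subst_rel != 0.
Proof.
rewrite subr_eq0; apply/eqP => Xh.
pose h' i : {mpoly K[n]} := if i == ek then 0 else 'X_i.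
have : subst h' (h ek) = h ek.
  apply: h_fixed; last exact: mem_nth.
  by move=> i ie; rewrite /h'; case: eqP ie => // ->; rewrite mem_nth.
rewrite -Xh substX /h' eqxx => /esym/eqP.
by rewrite -msize_poly_eq0 msizeX.
Qed.

Lemma take_S : take k.+1 e =i ek :: take k e.
Proof. by move=> i; rewrite (take_nth i0 ke) mem_rcons. Qed.

Lemma partial_substS p : subst (partial_subst k.+1) p =
  subst (fun i => if i == ek then h ek else 'X_i) (subst (partial_subst k) p).
Proof.
rewrite subst_comp; apply: eq_subst => i; rewrite /partial_subst take_S inE.
case: eqVneq => [->|ne] /=; first by rewrite (negPf ek_notin_take) substX eqxx.
case: ifP => ik; last by rewrite substX (negPf ne).
rewrite h_fixed //; last exact: (mem_take ik).
by move=> j je; rewrite ifN //; apply: contra je => /eqP->; exact: mem_nth.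
Qed.

Lemma partial_subst_kerS p : subst (partial_subst k) p = 0 -> subst (partial_subst k.+1) p = 0.
Proof. by rewrite partial_substS => ->; rewrite rmorph0. Qed.

Lemma partial_substS_rel : subst (partial_subst k.+1) subst_rel = 0.
Proof.
rewrite rmorphB /= substX /partial_subst take_S inE eqxx /= h_fixed ?subrr //.
  by move=> j je; rewrite ifN //; apply: contra je; exact: mem_take.
exact: mem_nth.
Qed.

(** The kernel grows at each step by the single generator [subst_rel]: p differs
    from its image q under the first k substitutions by an element of the old
    kernel, and q becomes 0 after the next substitution, which changes it by a
    multiple of [subst_rel]. *)
Lemma partial_subst_kerE p : subst (partial_subst k.+1) p = 0 ->
  exists p0 g, subst (partial_subst k) p0 = 0 /\ p = p0 + subst_rel * g.
Proof.
move=> p0; pose r i : {mpoly K[n]} := if i == ek then h ek else 'X_i.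
have [g fg] : exists g, subst (fun i => 'X_i) (subst (partial_subst k) p) -
    subst r (subst (partial_subst k) p) = subst_rel * g.
  apply: (rmorph_congr (is_ideal_dvd subst_rel)
    (f := subst (fun i => 'X_i)) (g := subst r)) => [c|i] /=.
    by rewrite !substC.
  rewrite !substX /r; case: eqVneq => [->|_]; first by exists 1; rewrite mulr1.
  by exists 0; rewrite subrr mulr0.
exists (p - subst (partial_subst k) p), g; split.
  by rewrite rmorphB /= partial_subst_idem subrr.
by rewrite -fg subst_id -partial_substS p0 subr0 subrK.
Qed.

End PartialSubstitution.

(** * Homogeneous components in graded modules *)

Section Graded.
Context {d : Order.disp_t} {P : finBPOrderType d} {K : fieldType}.
Local Notation S := {mpoly K[nvars P]}.
Local Notation gmod := (gmod P K).
Local Notation Zn := (Zn P).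
Implicit Types (M N : gmod).

Lemma phomog1 : phomog 0 (1 : S).
Proof.
move=> m; rewrite msupp1 inE => /eqP->.
by rewrite /mondeg big1 // => i _; rewrite mnm0E.
Qed.


Lemma gpartD M a u v : gpart M a u -> gpart M a v -> gpart M a (u + v).
Proof.
move=> hu hv; rewrite -[v]opprK -[- v]add0r; apply: gpartB => //.
by apply: gpartB => //; exact: gpart0.
Qed.

Lemma gpart_bigsum M a (J : Type) (r : seq J) (Q : pred J) (F : J -> M) :
  (forall j, Q j -> gpart M a (F j)) -> gpart M a (\sum_(j <- r | Q j) F j).
Proof. by move=> h; apply: big_ind => //; [exact: gpart0 | exact: gpartD]. Qed.

Lemma gmod_indep M (ds : seq Zn) (F : Zn -> M) : uniq ds ->
  (forall b, gpart M b (F b)) -> \sum_(b <- ds) F b = 0 ->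
  forall b, b \in ds -> F b = 0.
Proof.
move=> Uds hF sF b bds; have [_ ind] := gpart_sum M.
have := ind (size ds) (fun j => nth 0 ds j) (fun j => F (nth 0 ds j)).
have inj : injective (fun j : 'I_(size ds) => nth 0 ds j).
  by move=> i j /eqP; rewrite nth_uniq // => /eqP /val_inj.
have lt : (index b ds < size ds)%N by rewrite index_mem.
move=> /(_ inj (fun j => hF _)); rewrite -(big_mkord xpredT (fun j => F (nth 0 ds j))).
rewrite -(big_nth 0 xpredT F) => /(_ sF (Ordinal lt)) /=.
by rewrite nth_index.
Qed.

Lemma sum_by_degree M k (c : 'I_k -> Zn) (f : 'I_k -> M) (ds : seq Zn) :
  uniq ds -> (forall j, c j \in ds) ->
  \sum_(j < k) f j = \sum_(b <- ds) \sum_(j < k | c j == b) f j.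
Proof.
move=> Uds cds; rewrite (exchange_big_dep xpredT) //=; apply: eq_bigr => j _.
rewrite -big_filter (_ : [seq b <- ds | c j == b] = [:: c j]) ?big_seq1 //.
rewrite -(filter_pred1_uniq Uds (cds j)); apply: eq_filter => b /=.
by rewrite eq_sym.
Qed.

(** The components are given by a total function of the degree, so that
    decompositions of several elements can be compared degree by degree. *)
Lemma gmod_decomp M (m : M) : exists (F : Zn -> M) (ds : seq Zn),
  [/\ uniq ds, forall b, gpart M b (F b), forall b, b \notin ds -> F b = 0
    & m = \sum_(b <- ds) F b].
Proof.
have [/(_ m)[k [c [f [hf ->]]]] _] := gpart_sum M.
exists (fun b => \sum_(j < k | c j == b) f j), (undup (codom c)); split.
- exact: undup_uniq.
- by move=> b; apply: gpart_bigsum => j /eqP <-.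
- move=> b; rewrite mem_undup => /negP nb; rewrite big_pred0 // => j.
  by apply/negP => /eqP e; apply: nb; rewrite -e codom_f.
apply: sum_by_degree; first exact: undup_uniq.
by move=> j; rewrite mem_undup codom_f.
Qed.

(** A homogeneous element in the image of a homogeneous map has a homogeneous
    preimage, namely the component of the right degree of any preimage. *)
Lemma homog_lift M N (f : {additive M -> N}) (v : N) a b :
  (forall c u, gpart M c u -> gpart N (a + c) (f u)) ->
  gpart N (a + b) v -> (exists u, f u = v) ->
  exists2 u, gpart M b u & f u = v.
Proof.
move=> fdeg hv [u fu]; have [F [ds [Uds hF F0 uE]]] := gmod_decomp u.
exists (F b) => //; apply/eqP; rewrite -subr_eq0; apply/eqP.
pose G c : N := f (F (c - a)) - (if c == a + b then v else 0).
pose ds' := undup (b :: ds).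
have sF : u = \sum_(c <- ds') F c.
  rewrite uE /ds' /=; case: ifP => // [bds|/negbT nb].
    by rewrite undup_id.
  by rewrite big_cons undup_id // F0 // add0r.
have aK c : a + c - a = c by rewrite addrC addKr.
have -> : f (F b) - v = G (a + b) by rewrite /G eqxx aK.
have inj : injective (+%R a : Zn -> Zn) by exact: addrI.
apply: (@gmod_indep N (map (+%R a) ds')).
- by rewrite map_inj_uniq ?undup_uniq.
- move=> c; rewrite /G; apply: gpartB.
    by rewrite -{1}[c](subrK a) addrC; exact: fdeg.
  by case: eqP => [->//|_]; exact: gpart0.
- rewrite big_map /G big_split /= sumrN (eq_bigr (fun c => f (F c))); last first.
    by move=> c _; rewrite aK.
  rewrite -raddf_sum -sF fu (bigD1_seq b) ?undup_uniq ?mem_undup ?mem_head //=.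
  rewrite eqxx big1 ?addr0 ?subrr // => c cb.
  by rewrite (inj_eq inj) (negPf cb).
- by rewrite map_f // mem_undup mem_head.
Qed.

Lemma graded_comp M (U : M -> Prop) (ds : seq Zn) (F : Zn -> M) :
  graded_submodule U -> uniq ds -> (forall b, gpart M b (F b)) ->
  U (\sum_(b <- ds) F b) -> forall b, b \in ds -> U (F b).
Proof.
move=> [[U0 UD] Ugr] Uds hF /Ugr[k [c [f [hf sE]]]] b bds.
pose ds' := undup (ds ++ codom c).
pose G b := (if b \in ds then F b else 0) - \sum_(j < k | c j == b) f j.
have G0 : G b = 0.
  apply: (@gmod_indep M ds') => //.
  - exact: undup_uniq.
  - move=> b'; apply: gpartB; first by case: ifP => // _; exact: gpart0.
    by apply: gpart_bigsum => j /eqP <-; case: (hf j).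
  - rewrite /G big_split /= sumrN -(@sum_by_degree _ _ c) ?undup_uniq //; last first.
      by move=> j; rewrite mem_undup mem_cat codom_f orbT.
    rewrite -sE -big_mkcond -big_filter /=; apply/eqP; rewrite subr_eq0; apply/eqP.
    apply: perm_big; apply: uniq_perm => //.
      by rewrite filter_uniq ?undup_uniq.
    move=> x; rewrite mem_filter mem_undup mem_cat.
    by case: (x \in ds).
  by rewrite mem_undup mem_cat bds.
have -> : F b = \sum_(j < k | c j == b) f j.
  by apply/eqP; rewrite -subr_eq0; apply/eqP; move: G0; rewrite /G bds.
apply: big_ind => //.
  by move=> x y hx hy; rewrite -[x]scale1r; exact: UD.
by move=> j _; case: (hf j).
Qed.

(** Only additivity of [f] is asked for, so that it applies to the substitutions
    of S, which are not S-linear, as well as to maps of modules. *)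
Lemma ker_decomp M N a (f : {additive M -> N}) :
  (forall c u, gpart M c u -> gpart N (a + c) (f u)) ->
  forall u, f u = 0 -> exists (k : nat) (c : 'I_k -> Zn) (g : 'I_k -> M),
    (forall j, gpart M (c j) (g j) /\ f (g j) = 0) /\ u = \sum_(j < k) g j.
Proof.
move=> fdeg u fu; have [F [ds [Uds hF F0 uE]]] := gmod_decomp u.
exists (size ds), (fun j => nth 0 ds j), (fun j => F (nth 0 ds j)); split; last first.
  by rewrite uE (big_nth 0) big_mkord.
move=> j; split=> //.
pose b := nth 0 ds j; have bds : b \in ds by rewrite mem_nth.
have aK c : a + c - a = c by rewrite addrC addKr.
have := @gmod_indep N (map (+%R a) ds) (fun c => f (F (c - a))).
have inj : injective (+%R a : Zn -> Zn) by exact: addrI.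
rewrite map_inj_uniq // => /(_ Uds).
have h c : gpart N c (f (F (c - a))).
  by rewrite -{1}[c](subrK a) addrC; exact: fdeg.
move=> /(_ h); rewrite big_map (eq_bigr (fun c => f (F c))); last first.
  by move=> c _; rewrite aK.
rewrite -raddf_sum -uE => /(_ fu (a + b)).
by rewrite map_f // => /(_ isT); rewrite aK.
Qed.

Lemma graded_submodule_ker M N a (f : {linear M -> N}) :
  (forall c u, gpart M c u -> gpart N (a + c) (f u)) ->
  graded_submodule (fun u : M => f u = 0).
Proof.
move=> fdeg; split; last exact: ker_decomp fdeg.
split=> [|s u v hu hv]; first exact: raddf0.
by rewrite linearP hu hv scaler0 addr0.
Qed.

(** Essentialness applied to the submodule generated by [v] gives a multiple
    t v which need not be homogeneous; as U is graded, it contains the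
    components of t v, one of which is nonzero. *)
Lemma essential_homog M (U : M -> Prop) b (v : M) :
  graded_submodule U -> essential U -> gpart M b v -> v <> 0 ->
  exists c (s : S), [/\ phomog c s, U (s *: v) & s *: v <> 0].
Proof.
move=> Ugr Uess hv v0.
have [|| _ [[t ->] Utv tv0]] := Uess (fun w => exists t : S, w = t *: v).
- split.
    split=> [|s _ _ [t ->] [t' ->]]; first by exists 0; rewrite scale0r.
    by exists (s * t + t'); rewrite scalerDl scalerA.
  move=> _ [t ->]; have [k [c [g [hg ->]]]] := phomog_span t.
  exists k, (fun j => c j + b), (fun j => g j *: v); split; last by rewrite scaler_suml.
  by move=> j; split; [exact: gpartZ | exists (g j)].
- by exists v => //; exists 1; rewrite scale1r.
have [F [ds [Uds hF F0 tE]]] := @gmod_decomp (greg P K) t.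
have hFv c : gpart M c ((F (c - b) : S) *: v).
  by rewrite -{1}[c](subrK b); apply: gpartZ => //; exact: hF.
have inj : injective (fun c : Zn => c + b) by exact: addIr.
have tvE : t *: v = \sum_(c <- map (fun c => c + b) ds) (F (c - b) : S) *: v.
  by rewrite big_map tE scaler_suml; apply: eq_bigr => c _; rewrite addrK.
have Uc : forall c, c \in ds -> U ((F c : S) *: v).
  move=> c cds; have mU : uniq (map (fun c => c + b) ds) by rewrite map_inj_uniq.
  have := graded_comp Ugr mU hFv; rewrite -tvE => /(_ Utv (c + b)).
  by rewrite addrK; apply; exact: map_f.
have [/allP h|] := boolP (all (fun c => (F c : S) *: v == 0) ds).
  case: tv0; rewrite tE scaler_suml big_seq big1 // => c /h /eqP.
  by [].
case/allPn=> c cds /eqP h; exists c, (F c); split=> //; [exact: hF | exact: Uc].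
Qed.

End Graded.

(** * Injective modules and injective envelopes *)

Section Hom.
Context {d : Order.disp_t} {P : finBPOrderType d} {K : fieldType}.
Local Notation S := {mpoly K[nvars P]}.
Local Notation gmod := (gmod P K).
Local Notation Zn := (Zn P).
Implicit Types (M N : gmod).

Definition mk_additive (U V : zmodType) (f : U -> V) (hf : zmod_morphism f) :
  {additive U -> V} := HB.pack f (GRing.isZmodMorphism.Build U V f hf).

Definition mk_linear (R : nzRingType) (U V : lmodType R) (f : U -> V)
  (hf : linear f) : {linear U -> V} := HB.pack f (GRing.isLinear.Build R U V *:%R f hf).

Lemma mk_ghom M N (f : M -> N) : linear f ->
  (forall a u, gpart M a u -> gpart N a (f u)) -> exists g : ghom M N, g =1 f.
Proof. by move=> hf hd; exists (@GHom _ _ _ M N (mk_linear hf) hd). Qed.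

Lemma homog_coeff M (z v : M) a b : gpart M a z -> gpart M b v ->
  (exists s : S, v = s *: z) -> exists2 s : S, phomog (b - a) s & v = s *: z.
Proof.
move=> hz hv [s vE].
have hf : zmod_morphism (fun t : greg P K => (t : S) *: z).
  by move=> t t'; rewrite scalerBl.
have hv' : gpart M (a + (b - a)) v by rewrite addrC subrK.
have fdeg c (u : greg P K) : gpart (greg P K) c u -> gpart M (a + c) (mk_additive hf u).
  by move=> hu; rewrite addrC; exact: gpartZ.
have [|t ht tE] := homog_lift fdeg hv'; first by exists s; rewrite vE.
by exists t => //; rewrite -tE.
Qed.

Section Quot.
Variable p : gprime P K.
Local Notation I := (gprime_ideal p).
Local Notation cl s := (\pi_({ideal_quot I}) s : gquot p).

Lemma cl_scale (s t : S) : s *: cl t = cl (s * t).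
Proof. by rewrite rmorphM. Qed.

Lemma cl_eq0 (s : S) : cl s = 0 <-> s \in (I : {pred S}).
Proof. exact: squot_pi0. Qed.

Lemma cl_surj (u : gquot p) : exists s : S, u = cl s.
Proof. by exists (repr (u : squot p)); rewrite reprK. Qed.

Lemma cl_part a (s : S) : phomog a s -> gpart (gquot p) a (cl s).
Proof. by move=> hs; exists s. Qed.

Lemma quot_regular (f : S) (u : gquot p) : f \notin (I : {pred S}) -> f *: u = 0 -> u = 0.
Proof.
have [s ->] := cl_surj u; rewrite cl_scale => fI /cl_eq0.
by rewrite prime_idealrM (negPf fI) => /cl_eq0.
Qed.

Lemma quot_killed (f : S) (u : gquot p) : f \in (I : {pred S}) -> f *: u = 0.
Proof.
by have [s ->] := cl_surj u => fI; rewrite cl_scale; apply/cl_eq0; rewrite mulrC idealMr.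
Qed.

(** S/p, suitably shifted, is the free object on a homogeneous element killed
    by p. *)
Lemma quot_hom M (v : M) b : gpart M b v ->
  (forall g, g \in (I : {pred S}) -> g *: v = 0) ->
  exists f : ghom (shift (gquot p) (- b)) M, forall s : S, f (cl s) = s *: v.
Proof.
move=> hv pv.
have E s : (repr (cl s : squot p) : S) *: v = s *: v.
  apply/eqP; rewrite -subr_eq0 -scalerBl; apply/eqP; apply: pv.
  by rewrite Quotient.idealrBE; apply/eqP; exact: reprK.
have [||f fE] := @mk_ghom (shift (gquot p) (- b)) M
    (fun u => (repr (u : squot p) : S) *: v).
- move=> t u1 u2; have [s1 ->] := cl_surj u1; have [s2 ->] := cl_surj u2.
  rewrite [t *: _]cl_scale -[X in repr X]/(cl (t * s1) + cl s2) -rmorphD !E.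
  by rewrite scalerDl scalerA.
- move=> a _ [s hs ->]; rewrite E.
  by rewrite -[a](subrK b) [a - b]addrC; apply: gpartZ.
by exists f => s; rewrite fE E.
Qed.

(** As f is regular on S/p, the map S/p -> E sending 1 to v extends along
    multiplication by f on S/p; the image of 1 under the extension is a quotient
    of v by f which is again killed by p. *)
Lemma injective_div (E : gmod) (f : S) a b (v : E) : injective_object E ->
  phomog a f -> f \notin (I : {pred S}) -> gpart E b v ->
  (forall g, g \in (I : {pred S}) -> g *: v = 0) ->
  exists u : E, [/\ gpart E (b - a) u, f *: u = v &
                    forall g, g \in (I : {pred S}) -> g *: u = 0].
Proof.
move=> injE hf fI hv pv; have [phi phiE] := quot_hom hv pv.
have [||i iE] := @mk_ghom (shift (gquot p) (- b)) (shift (gquot p) (- (b - a)))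
    (fun u => f *: (u : gquot p)).
- by move=> t u1 u2; rewrite scalerDr !scalerA mulrC.
- move=> c u hu; rewrite /= /shift_part opprB -addrA.
  exact: (@gpartZ _ _ _ (gquot p)).
have i_inj : injective i.
  move=> u1 u2; rewrite !iE => /eqP; rewrite -subr_eq0 -scalerBr => /eqP h.
  by apply/eqP; rewrite -subr_eq0; apply/eqP; exact: quot_regular h.
have [g gE] := injE _ _ i phi i_inj.
exists (g (cl 1)); split.
- apply: (gfun_deg g); rewrite /= /shift_part addNr.
  by apply: cl_part; exact: phomog1.
- by rewrite -linearZ -(iE (cl 1)) gE phiE scale1r.
- move=> q qI; rewrite -linearZ.
  have -> : q *: (cl 1 : shift (gquot p) (- (b - a))) = 0 by exact: quot_killed.
  exact: raddf0.
Qed.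

Section Envelope.
Variables (E : gmod) (env : ghom (gquot p) E).
Hypothesis Eenv : injective_envelope env.

(** Multiplication by s is injective on S/p, hence on its essential extension E.
    By injectivity of E it then has a retraction g, which is injective for the
    same reason, and so is a two-sided inverse. *)
Lemma envelope_unit c (s : S) : phomog c s -> s \notin (I : {pred S}) ->
  exists g : ghom (shift E c) E,
    (forall u, s *: g u = u) /\ (forall u : E, g (s *: u) = u).
Proof.
move=> hs sI; have [injE env_inj Eess] := Eenv.
have ker0 (N : gmod) a (f : {linear E -> N}) :
    (forall b u, gpart E b u -> gpart N (a + b) (f u)) ->
    (forall u, f (env u) = 0 -> u = 0) -> injective f.
  move=> fdeg f0; apply/raddf_inj => u fu; apply/eqP/negPn/negP => /eqP u0.
  have [|v [fv [w wE]]] := Eess _ (graded_submodule_ker fdeg); first by exists u.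
  by rewrite -wE in fv *; rewrite (f0 _ fv); case; exact: raddf0.
have [||i iE] := @mk_ghom E (shift E c) (fun u => s *: u).
- by move=> t u1 u2; rewrite scalerDr !scalerA mulrC.
- by move=> a u hu; apply: (@gpartZ _ _ _ E).
have i_inj : injective i.
  apply: (ker0 _ 0) => [b u hu|u]; first by rewrite add0r; exact: gfun_deg.
  rewrite iE -linearZ -[RHS](raddf0 env) => /env_inj; exact: quot_regular.
have id_lin : linear (id : E -> E) by [].
have [id' id'E] := @mk_ghom E E id id_lin (fun _ _ h => h).
have [g gE] := injE _ _ i id' i_inj.
have gs (u : E) : g (s *: u) = u by rewrite -[s *: u]iE gE id'E.
exists g; split=> // u.
have g_inj : injective g.
  apply: (ker0 _ (- c) (g : {linear E -> E})) => [b w hw|w gw0].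
    by apply: (gfun_deg g); rewrite /= /shift_part addrA subrr add0r.
  by apply: env_inj; rewrite raddf0 -[LHS]gs linearZ /= gw0 scaler0.
by apply: g_inj; rewrite gs.
Qed.
(** Multiplying by s1 and dividing by s2 changes degrees by (c + a) - c = a. *)
Lemma envelope_shift c a (s1 s2 : S) :
  phomog (c + a) s1 -> s1 \notin (I : {pred S}) ->
  phomog c s2 -> s2 \notin (I : {pred S}) -> giso (shift E (- a)) E.
Proof.
move=> h1 n1 h2 n2.
have [g1 [g1K g1s]] := envelope_unit h1 n1.
have [g2 [g2K g2s]] := envelope_unit h2 n2.
have aK b : c + b = (c + a) + (- a + b) by rewrite addrA addrK.
have [||f fE] := @mk_ghom (shift E (- a)) E (fun u => g2 (s1 *: (u : E))).
- move=> t u v; rewrite scalerDr scalerA [s1 * t]mulrC -scalerA.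
  exact: (linearP g2).
- move=> b u hu; apply: (gfun_deg g2); rewrite /= /shift_part aK.
  exact: (@gpartZ _ _ _ E).
have [||g gE] := @mk_ghom E (shift E (- a)) (fun u => g1 (s2 *: (u : E))).
- move=> t u v; rewrite scalerDr scalerA [s2 * t]mulrC -scalerA.
  exact: (linearP g1).
- move=> b u hu; rewrite /= /shift_part; apply: (gfun_deg g1).
  rewrite /= /shift_part -aK; exact: (@gpartZ _ _ _ E).
exists f, g; split=> u.
  by rewrite gE fE g2K g1s.
by rewrite fE gE g1K g2s.
Qed.

End Envelope.
End Quot.
End Hom.

(** * Cutting down a minimal injective resolution *)

(** The complex is indexed by natural numbers, with C_n in cohomological degree
    n - N. It resolves a free module with generator z0 of degree w, and
    0 = p_0 < ... < p_m is a chain of primes in which p_(k+1) = p_k + (f_k). *)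
Section Resolution.
Context {d : Order.disp_t} {P : finBPOrderType d} {K : fieldType}.
Local Notation S := {mpoly K[nvars P]}.
Local Notation gmod := (gmod P K).
Local Notation Zn := (Zn P).

Definition killed (p : gprime P K) (M : gmod) (v : M) : Prop :=
  forall q : S, q \in (gprime_ideal p : {pred S}) -> q *: v = 0.

Lemma killedZ (p : gprime P K) (M : gmod) (s : S) (v : M) :
  killed p v -> killed p (s *: v).
Proof. by move=> h q /h qv; rewrite scalerA mulrC -scalerA qv scaler0. Qed.

Lemma killedB (p : gprime P K) (M : gmod) (u v : M) :
  killed p u -> killed p v -> killed p (u - v).
Proof. by move=> hu hv q hq; rewrite scalerBr hu // hv // subrr. Qed.

Lemma killed_hom (p : gprime P K) (M N : gmod) (f : ghom M N) (v : M) :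
  killed p v -> killed p (f v).
Proof. by move=> h q /h qv; rewrite -linearZ /= qv raddf0. Qed.

Variables (C : nat -> gmod) (del : forall n, ghom (C n) (C n.+1)).
Variables (w : Zn) (z0 : C 0).
Hypothesis injC : forall n, injective_object (C n).
Hypothesis del_exact : forall n v, del n.+1 v = 0 <-> exists u, del n u = v.
Hypothesis del_ess : forall n, essential (fun v : C n => del n v = 0).
Hypothesis z0_part : gpart (C 0) w z0.
Hypothesis del0 : forall v, del 0 v = 0 <-> exists s : S, v = s *: z0.
Hypothesis z0_free : forall s : S, s *: z0 = 0 -> s = 0.

Variables (m : nat) (p : nat -> gprime P K) (f : nat -> S) (dg : nat -> Zn).
Hypothesis p0 : forall s, s \in (gprime_ideal (p 0) : {pred S}) -> s = 0.
Hypothesis f_part : forall k, (k < m)%N -> phomog (dg k) (f k).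
Hypothesis f_notin : forall k, (k < m)%N -> f k \notin (gprime_ideal (p k) : {pred S}).
Hypothesis f_in : forall k, (k < m)%N -> f k \in (gprime_ideal (p k.+1) : {pred S}).
Hypothesis pS : forall k, (k < m)%N -> forall s,
  s \in (gprime_ideal (p k) : {pred S}) -> s \in (gprime_ideal (p k.+1) : {pred S}).
Hypothesis pE : forall k, (k < m)%N -> forall s,
  s \in (gprime_ideal (p k.+1) : {pred S}) ->
  exists s0 g, s0 \in (gprime_ideal (p k) : {pred S}) /\ s = s0 + f k * g.

Definition cycle_deg k : Zn := w - \sum_(i < k) dg i.

(** In terms of homogeneous elements only, the cocycles of C_k killed by p_k form
    a shifted copy of S/p_k in which z corresponds to 1. *)
Definition fundamental k (z : C k) : Prop :=
  [/\ gpart (C k) (cycle_deg k) z, del k z = 0, killed (p k) z,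
      (forall b v, gpart (C k) b v -> del k v = 0 -> killed (p k) v ->
         exists2 s : S, phomog (b - cycle_deg k) s & v = s *: z)
    & (forall c (s : S), phomog c s -> s *: z = 0 -> s \in (gprime_ideal (p k) : {pred S}))].

Definition acyclic_above k : Prop := forall n, (k <= n)%N ->
  forall b (v : C n.+1), gpart (C n.+1) b v -> del n.+1 v = 0 -> killed (p k) v ->
  exists u : C n, [/\ gpart (C n) b u, killed (p k) u & del n u = v].

Lemma cycle_degS k : cycle_deg k.+1 = cycle_deg k - dg k.
Proof. by rewrite /cycle_deg big_ord_recr /= opprD addrA. Qed.

Lemma killed0 (M : gmod) (v : M) : killed (p 0) v.
Proof. by move=> q /p0->; rewrite scale0r. Qed.

Lemma killed_next k (M : gmod) (u : M) : (k < m)%N ->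
  killed (p k) u -> f k *: u = 0 -> killed (p k.+1) u.
Proof.
move=> km hu fu q /(pE km)[s0 [g [hs0 ->]]].
by rewrite scalerDl hu // add0r mulrC -scalerA fu scaler0.
Qed.

Lemma killed_prev k (M : gmod) (u : M) : (k < m)%N ->
  killed (p k.+1) u -> killed (p k) u.
Proof. by move=> km hu q /(pS km); exact: hu. Qed.

Lemma base_fundamental : fundamental z0.
Proof.
have sh0 : cycle_deg 0 = w by rewrite /cycle_deg big_ord0 subr0.
split; rewrite ?sh0 //.
- by apply/del0; exists 1; rewrite scale1r.
- exact: killed0.
- by move=> b v hv /del0 hs _; apply: homog_coeff.
- by move=> c s _ /z0_free ->; exact: rpred0.
Qed.

Lemma base_acyclic : acyclic_above 0.
Proof.
move=> n _ b v hv dv _; have ex : exists u, del n u = v by apply/del_exact.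
have [||u hu duE] := @homog_lift _ _ _ (C n) (C n.+1) (del n) v 0 b _ _ ex.
- by move=> c u hu; rewrite add0r; exact: gfun_deg.
- by rewrite add0r.
by exists u; split=> //; exact: killed0.
Qed.

(** If v were nonzero, minimality would give a nonzero cocycle in C_k killed by
    p_(k+1). It has the form g z, and f_k g z = 0 puts g in p_k, so that g z = 0. *)
Lemma killed_next_eq0 k (z : C k) : (k < m)%N -> fundamental z ->
  forall b v, gpart (C k) b v -> killed (p k.+1) v -> v = 0.
Proof.
move=> km [hz dz kz gen free] b v hv kv; apply/eqP/negPn/negP => /eqP v0.
have Ugr : graded_submodule (fun v : C k => del k v = 0).
  apply: (@graded_submodule_ker _ _ _ _ _ 0 (del k)) => c u hu.
  by rewrite add0r; exact: gfun_deg.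
have [c [s [hs ds sv0]]] := essential_homog Ugr (@del_ess k) hv v0.
have ksv : killed (p k.+1) (s *: v) by exact: killedZ.
have [g hg svE] := gen _ _ (gpartZ hs hv) ds (killed_prev km ksv).
have : f k * g \in (gprime_ideal (p k) : {pred S}).
  apply: (free _ _ (phomogM (f_part km) hg)).
  by rewrite -scalerA -svE; apply: ksv; exact: f_in.
by rewrite prime_idealrM (negPf (f_notin km)) /= => /kz; rewrite -svE.
Qed.

(** A cocycle v killed by p_(k+1) is d u with u killed by p_k. Then f_k u is a
    cocycle, hence f_k u = d (f_k y) for some y killed by p_k, and u - d y is a
    primitive of v that f_k kills as well. *)
Lemma next_acyclic k : (k < m)%N -> acyclic_above k -> acyclic_above k.+1.
Proof.
move=> km ac [//|n]; rewrite ltnS => kn b v hv dv kv.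
have [u [hu ku uv]] := ac _ (leqW kn) _ _ hv dv (killed_prev km kv).
have dfu : del n.+1 (f k *: u) = 0.
  by rewrite linearZ /= uv; apply: kv; exact: f_in.
have [x [hx kx xE]] := ac _ kn _ _ (gpartZ (f_part km) hu) dfu (killedZ _ ku).
have [y [hy fy ky]] := injective_div (@injC n) (f_part km) (f_notin km) hx kx.
exists (u - del n y); split.
- apply: gpartB => //; apply: gfun_deg.
  by rewrite addrC addKr in hy.
- apply: killed_next => //; first by apply: killedB => //; exact: killed_hom.
  by rewrite scalerBr -linearZ /= fy xE subrr.
- have -> : del n.+1 (u - del n y) = del n.+1 u - del n.+1 (del n y) by exact: raddfB.
  rewrite uv (_ : del n.+1 (del n y) = 0) ?subr0 //.
  by apply/del_exact; exists y.
Qed.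

(** If z = f_k u with u killed by p_k, then d u is the next fundamental cocycle:
    this is the inverse of the connecting homomorphism. *)
Lemma next_fundamental k (z : C k) : (k < m)%N -> fundamental z ->
  acyclic_above k -> exists z' : C k.+1, fundamental z'.
Proof.
move=> km fz ac; have [hz dz kz gen free] := fz.
have [u [hu fu ku]] := injective_div (@injC k) (f_part km) (f_notin km) hz kz.
exists (del k u); split.
- by rewrite cycle_degS; exact: gfun_deg.
- by apply/del_exact; exists u.
- apply: killed_next => //; first exact: killed_hom.
  by rewrite -linearZ /= fu.
- move=> b v hv dv kv.
  have [u' [hu' ku' uv']] := ac _ (leqnn k) _ _ hv dv (killed_prev km kv).
  have dfu : del k (f k *: u') = 0.
    by rewrite linearZ /= uv'; apply: kv; exact: f_in.
  have hfu' := gpartZ (f_part km) hu'.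
  have [s hs sE] := gen _ _ hfu' dfu (killedZ _ ku').
  have e : dg k + b - cycle_deg k = b - cycle_deg k.+1.
    by rewrite cycle_degS; move: (cycle_deg k) => t; rewrite opprB addrA [b + _]addrC.
  rewrite e in hs; exists s => //.
  suff : u' - s *: u = 0.
    by move/eqP; rewrite subr_eq0 => /eqP e'; rewrite -uv' e' linearZ.
  have hsu : gpart (C k) b (s *: u).
    by rewrite -[b](subrK (cycle_deg k.+1)); apply: gpartZ => //; rewrite cycle_degS.
  apply: (killed_next_eq0 km fz (gpartB hu' hsu)).
  apply: killed_next => //; first by apply: killedB => //; exact: killedZ.
  by rewrite scalerBr sE scalerA mulrC -scalerA fu subrr.
move=> c s hs sdu.
have dsu : del k (s *: u) = 0 by rewrite linearZ.
have hsu := gpartZ hs hu.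
have [g hg suE] := gen _ _ hsu dsu (killedZ _ ku).
have e : dg k + (c + (cycle_deg k - dg k) - cycle_deg k) = c.
  move: (cycle_deg k) => t.
  by rewrite [t - _]addrC [c + (_ + _)]addrA addrK addrCA subrr addr0.
have hfg : phomog c (f k * g) by rewrite -[c]e; exact: phomogM (f_part km) hg.
have : s - f k * g \in (gprime_ideal (p k) : {pred S}).
  apply: (free _ _ (phomogB hs hfg)).
  by rewrite scalerBl -scalerA -suE scalerA mulrC -scalerA fu subrr.
move/(pS km) => h; rewrite -[s](subrK (f k * g)); apply: rpredD => //.
by rewrite mulrC idealMr ?f_in.
Qed.

Lemma fundamental_exists k : (k <= m)%N -> exists z : C k, fundamental z.
Proof.
move=> km; suff [] : (exists z : C k, fundamental z) /\ acyclic_above k by [].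
elim: k km => [|k IH] km.
  by split; [exists z0; exact: base_fundamental | exact: base_acyclic].
have [[z fz] ac] := IH (ltnW km).
by split; [exact: next_fundamental fz ac | exact: next_acyclic].
Qed.

(** The degree b of any nonzero element killed by p_m agrees with the degree of
    the fundamental cocycle up to degrees of elements outside p_m: by minimality
    some s v is a nonzero cocycle, which is g times the fundamental one. *)
Lemma killed_degree b (v : C m) : gpart (C m) b v -> v <> 0 -> killed (p m) v ->
  exists c (s g : S), [/\ phomog c s, s \notin (gprime_ideal (p m) : {pred S}),
    phomog (c + b - cycle_deg m) g & g \notin (gprime_ideal (p m) : {pred S})].
Proof.
move=> hv v0 kv; have [z [hz dz kz gen _]] := fundamental_exists (leqnn m).
have Ugr : graded_submodule (fun v : C m => del m v = 0).
  apply: (@graded_submodule_ker _ _ _ _ _ 0 (del m)) => c u hu.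
  by rewrite add0r; exact: gfun_deg.
have [c [s [hs ds sv0]]] := essential_homog Ugr (@del_ess m) hv v0.
have [g hg svE] := gen _ _ (gpartZ hs hv) ds (killedZ _ kv).
exists c, s, g; split=> //; apply/negP => h; apply: sv0; first exact: kv.
by rewrite svE; exact: kz.
Qed.

End Resolution.

(** * Lower intervals of a simplicial poset *)

Section Poset.
Context {d : Order.disp_t} (P : finBPOrderType d).
Local Open Scope order_scope.

Lemma has_rankP (x : P) k : has_rank x k -> exists f : {set 'I_k} -> P,
  (forall A B, (f A <= f B) = (A \subset B)) /\
  (forall y, y <= x <-> exists A, y = f A).
Proof.
case/existsP => f /andP[/forallP fle /forallP fim]; exists f; split.
  by move=> A B; have := fle A => /forallP/(_ B)/eqP.
move=> y; rewrite -(eqP (fim y)); split=> [/codomP//|[A ->]]; exact: codom_f.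
Qed.

Lemma rank1P (y : P) : has_rank y 1 <->
  y != \bot /\ forall u, u <= y -> u = \bot \/ u = y.
Proof.
split=> [/has_rankP[f [fle fim]]|[y0 ymin]].
  have fI : injective f.
    by move=> A B AB; apply/eqP; rewrite eqEsubset -!fle AB lexx.
  have set01 (A : {set 'I_1}) : A = set0 \/ A = setT.
    have [->|[i iA]] := set_0Vmem A; first by left.
    by right; apply/setP => j; rewrite inE (ord1 j) -(ord1 i) iA.
  have f0 : f set0 = \bot.
    have /fim[A bA] : \bot <= y by exact: le0x.
    by apply/eqP; rewrite -lex0 [X in _ <= X]bA fle sub0set.
  have [A yA] : exists A, y = f A by apply/fim.
  have [B fB] : exists B, f setT = f B by exists setT.
  have yT : y = f setT.
    apply: le_anti; rewrite {1}yA fle subsetT /=.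
    by apply/fim; exists setT.
  split=> [|u /fim[A' ->]].
    rewrite yT -f0 (inj_eq fI); apply/eqP => /setP/(_ ord0).
    by rewrite !inE.
  by have [->|->] := set01 A'; [left | right].
apply/existsP; exists [ffun A : {set 'I_1} => if A == set0 then \bot else y].
have set01 (A : {set 'I_1}) : A != set0 -> A = setT.
  case/set0Pn => i iA.
  by apply/setP => j; rewrite inE (ord1 j) -(ord1 i) iA.
have T0 : [set: 'I_1] != set0 by apply/set0Pn; exists ord0.
apply/andP; split.
  apply/forallP => A; apply/forallP => B; rewrite !ffunE; apply/eqP.
  case: (eqVneq A set0) => [->|/set01 ->]; first by rewrite le0x sub0set.
  case: (eqVneq B set0) => [->|/set01 ->]; last by rewrite lexx subxx.
  by rewrite lex0 subset0 (negPf y0) (negPf T0).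
apply/forallP => u; apply/eqP; apply/codomP/idP => [[A ->]|/ymin[->|->]].
- by rewrite ffunE; case: ifP => // _; exact: le0x.
- by exists set0; rewrite ffunE eqxx.
- by exists setT; rewrite ffunE (negPf T0).
Qed.

Lemma vertex_neq_bot (y : vertex P) : val y != \bot.
Proof. by have /rank1P[] := valP y. Qed.

Definition supp (z : P) : {set vertex P} := [set y | val y <= z].

Lemma supp_mono a b : a <= b -> supp a \subset supp b.
Proof. by move=> ab; apply/subsetP => y; rewrite !inE => /le_trans; apply. Qed.

Lemma supp_bot : supp \bot = set0.
Proof.
by apply/setP => y; rewrite !inE lex0 (negPf (vertex_neq_bot y)).
Qed.

Lemma supp_vertex (y : vertex P) : supp (val y) = [set y].
Proof.
apply/setP => u; rewrite !inE; apply/idP/eqP => [uy|-> //].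
have /rank1P[_ /(_ _ uy)[/eqP|/val_inj //]] := valP y.
by rewrite (negPf (vertex_neq_bot u)).
Qed.

Hypothesis simpP : simplicial P.

(** The vertices below x are the images of the singletons under an isomorphism of
    the Boolean algebra with the interval. *)
Lemma interval_atoms (x : P) : exists k (f : {set 'I_k} -> P) (v : 'I_k -> vertex P),
  [/\ forall z, z <= x <-> exists A, z = f A,
      forall A i, (val (v i) <= f A) = (i \in A),
      forall A B, (f A <= f B) = (A \subset B) &
      forall y : vertex P, val y <= x -> exists i, y = v i].
Proof.
have [k /has_rankP[f [fle fim]]] := simpP x.
have fI : injective f.
  by move=> A B AB; apply/eqP; rewrite eqEsubset -!fle AB lexx.
have f0 : f set0 = \bot.
  have /fim[A bA] : \bot <= x by exact: le0x.
  by apply/eqP; rewrite -lex0 [X in _ <= X]bA fle sub0set.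
have at1 i : has_rank (f [set i]) 1.
  apply/rank1P; split; first by rewrite -f0 (inj_eq fI) -cards_eq0 cards1.
  move=> u ui; have /fim[A uA] : u <= x.
    by apply: le_trans ui _; apply/fim; exists [set i].
  move: ui; rewrite uA fle subset1 => /orP[]/eqP ->; [by right | by left].
exists k, f, (fun i => Sub (f [set i]) (at1 i)); split=> //.
  by move=> A i; rewrite SubK fle sub1set.
move=> y yx; have /fim[A yA] := yx.
have A0 : A != set0.
  by apply/eqP => A0; have := vertex_neq_bot y; rewrite yA A0 f0 eqxx.
case/set0Pn: A0 => i iA; exists i; apply: val_inj; rewrite SubK.
have /rank1P[_ /(_ (f [set i]))] := valP y.
rewrite yA fle sub1set iA => /(_ isT) [fi|//].
by have /rank1P[] := at1 i; rewrite fi eqxx.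
Qed.

Lemma supp_le x a b : a <= x -> b <= x -> supp a \subset supp b -> a <= b.
Proof.
have [k [f [v [fim vle fle vs]]]] := interval_atoms x.
case/fim=> A -> /fim[B ->] /subsetP AB; rewrite fle; apply/subsetP => i iA.
by have := AB (v i); rewrite !inE !vle; apply.
Qed.

Lemma supp_inj x a b : a <= x -> b <= x -> supp a = supp b -> a = b.
Proof.
move=> ax bx ab; apply: le_anti.
by apply/andP; split; apply: (supp_le (x := x)) => //; rewrite ab.
Qed.

(** Together with [supp_le], this identifies the interval below x with the Boolean
    algebra of sets of vertices below x; the rest of the development uses
    intervals only through these two facts. *)
Lemma supp_surj x (V : {set vertex P}) : V \subset supp x ->
  exists2 z, z <= x & supp z = V.
Proof.
have [k [f [v [fim vle fle vs]]]] := interval_atoms x => /subsetP Vx.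
pose A := [set i | v i \in V].
have fAx : f A <= x by apply/fim; exists A.
exists (f A) => //; apply/setP => y; rewrite inE; apply/idP/idP => [yA|yV].
  have [i yi] := vs y (le_trans yA fAx).
  by move: yA; rewrite yi vle inE.
have [i yi] : exists i, y = v i by apply: vs; have := Vx _ yV; rewrite inE.
by rewrite yi vle inE -yi.
Qed.

Lemma pmeet_supp x a b : a <= x -> b <= x ->
  pmeet a b <= x /\ supp (pmeet a b) = supp a :&: supp b.
Proof.
move=> ax bx; have [|m mx ms] := @supp_surj x (supp a :&: supp b).
  by apply: subset_trans (subsetIl _ _) (supp_mono ax).
suff -> : pmeet a b = m by [].
have mP u : (u <= m) = (u <= a) && (u <= b).
  apply/idP/andP => [um|[ua ub]].
    have ma : m <= a by apply: (supp_le (x := x)) => //; rewrite ms subsetIl.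
    have mb : m <= b by apply: (supp_le (x := x)) => //; rewrite ms subsetIr.
    by split; apply: le_trans um _.
  apply: (supp_le (x := x)) => //; first exact: le_trans ua ax.
  by rewrite ms subsetI !supp_mono.
rewrite /pmeet; case: pickP => [z /forallP zP|/(_ m)/negP[]] /=; last first.
  by apply/forallP => u; rewrite mP.
apply: le_anti; have := eqP (zP z); rewrite lexx -mP => <- /=.
by rewrite (eqP (zP m)) -mP lexx.
Qed.

(** Among the minimal upper bounds of a and b, of which there may be several in P,
    exactly one lies below x. *)
Lemma joins_supp x a b : a <= x -> b <= x ->
  exists j, [/\ j <= x, supp j = supp a :|: supp b &
    forall z, (z \in joins a b) && (z <= x) = (z == j)].
Proof.
move=> ax bx; have [|j jx js] := @supp_surj x (supp a :|: supp b).
  by rewrite subUset !supp_mono.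
have jP u : u <= x -> a <= u -> b <= u -> j <= u.
  move=> ux au bu; apply: (supp_le (x := x)) => //.
  by rewrite js subUset !supp_mono.
have aj : a <= j by apply: (supp_le (x := x)) => //; rewrite js subsetUl.
have bj : b <= j by apply: (supp_le (x := x)) => //; rewrite js subsetUr.
exists j; split=> // z; apply/andP/eqP => [[]|->]; rewrite inE.
  case/and3P => az bz /forallP/(_ j); rewrite aj bj /= => /implyP zmin zx.
  by have /eqP -> : j == z by apply: zmin; exact: jP.
split=> //; rewrite aj bj /=; apply/forallP => u; apply/implyP => /and3P[au bu uj].
by rewrite eq_le uj jP // (le_trans uj).
Qed.

End Poset.

(** * The prime p_x as the kernel of a substitution *)

Section FacePrime.
Context {d : Order.disp_t} (P : finBPOrderType d) (K : fieldType).
Hypothesis simpP : simplicial P.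
Variable x : P.
Local Notation S := {mpoly K[nvars P]}.
Local Notation t := (@tvar d P K).

Definition elt (i : 'I_(nvars P)) : P := val (enum_val i : pstar P).

(** The image of t_z in S/p_x, written as a monomial in the vertices below x. *)
Definition face_mon (z : P) : S :=
  if (z <= x)%O then \prod_(y in supp z) t (val y) else 0.

Definition face_subst : 'I_(nvars P) -> S := fun i => face_mon (elt i).

Lemma tvar_elt i : t (elt i) = 'X_i.
Proof. by rewrite /tvar /elt valK enum_valK. Qed.

Lemma tvar_bot : t \bot%O = 1.
Proof. by rewrite /tvar insubF // eqxx. Qed.

Lemma tvarE z : z != \bot%O -> exists2 i, z = elt i & t z = 'X_i.
Proof.
move=> z0; exists (enum_rank (Sub z z0 : pstar P)).
  by rewrite /elt enum_rankK SubK.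
by rewrite /tvar insubT.
Qed.

Lemma face_mon_bot : face_mon \bot%O = 1.
Proof. by rewrite /face_mon le0x supp_bot big_set0. Qed.

Lemma face_subst_tvar z : subst face_subst (t z) = face_mon z.
Proof.
have [->|/tvarE[i -> ->]] := eqVneq z \bot%O; last by rewrite substX.
by rewrite tvar_bot rmorph1 face_mon_bot.
Qed.

Lemma face_mon_vertex (y : vertex P) : (val y <= x)%O -> face_mon (val y) = t (val y).
Proof. by move=> yx; rewrite /face_mon yx supp_vertex big_set1. Qed.

Lemma ideal_gen_is_ideal (G : S -> Prop) : is_ideal (@ideal_gen d P K G).
Proof.
split.
  by exists 0, (fun=> 0), (fun=> 0); split=> [[]|] //; rewrite big_ord0.
move=> s u v [k [c [g [hg ->]]]] [k' [c' [g' [hg' ->]]]].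
exists (k + k')%N,
  (fun j => match split j with inl i => s * c i | inr i => c' i end),
  (fun j => match split j with inl i => g i | inr i => g' i end); split.
  by move=> j; case: split.
rewrite big_split_ord /= mulr_sumr; congr (_ + _); apply: eq_bigr => i _.
  by rewrite -[lshift _ i]/(unsplit (inl i)) unsplitK mulrA.
by rewrite -[rshift _ i]/(unsplit (inr i)) unsplitK.
Qed.

Lemma ideal_gen_gen (G : S -> Prop) g : G g -> @ideal_gen d P K G g.
Proof.
by move=> hg; exists 1, (fun=> 1), (fun=> g); split=> //; rewrite big_ord1 mul1r.
Qed.

Lemma sp_prime_is_ideal : is_ideal (@sp_prime d P K x).
Proof.
split.
  exists 0, 0; split; [| |by rewrite addr0]; exact: is_ideal0 (ideal_gen_is_ideal _).
move=> s _ _ [g [h [hg hh ->]]] [g' [h' [hg' hh' ->]]].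
exists (s * g + g'), (s * h + h'); split.
- by apply: (ideal_gen_is_ideal _).2.
- by apply: (ideal_gen_is_ideal _).2.
- by rewrite mulrDr addrACA.
Qed.

Lemma face_mon_mul a b z : (a <= x)%O -> (b <= x)%O -> (z <= x)%O ->
  supp a = supp b :|: supp z -> supp b :&: supp z = set0 ->
  face_mon a = face_mon b * face_mon z.
Proof.
move=> ax bx zx ab b0; rewrite /face_mon ax bx zx ab (big_setID (supp b)) /=.
rewrite setUK setDUl setDv set0U.
have /setDidPl -> // : [disjoint supp z & supp b].
by rewrite -setI_eq0 setIC b0.
Qed.

(** By induction on the number of vertices of z: if z' is obtained from z by
    removing a vertex y, the relation of y and z' reads t_y t_z' = t_z modulo p_x,
    as y and z' have meet 0 and their other joins are not below x. *)
Lemma tvar_face_mon z : sp_prime x (t z - face_mon z).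
Proof.
have idI := sp_prime_is_ideal.
have above u : ~~ (u <= x)%O -> sp_prime x (t u).
  move=> ux; have u0 : u != \bot%O by apply: contra ux => /eqP->; exact: le0x.
  exists (t u), 0; split; [|exact: is_ideal0 (ideal_gen_is_ideal _)|by rewrite addr0].
  by apply: ideal_gen_gen; exists (Sub u u0 : pstar P); rewrite SubK.
have [zx|zx] := boolP (z <= x)%O; last first.
  by rewrite /face_mon (negPf zx) subr0; exact: above.
have [k] := ubnP #|supp z|; elim: k z zx => // k IH z zx zk.
have [s0|[y yz]] := set_0Vmem (supp z).
  have -> : z = \bot%O by apply: (supp_inj simpP zx) => //; rewrite s0 supp_bot.
  by rewrite tvar_bot face_mon_bot subrr; exact: is_ideal0.
have [|z' z'x z's] := @supp_surj _ _ simpP x (supp z :\ y).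
  by apply: subset_trans (subD1set _ _) (supp_mono zx).
have yzle : (val y <= z)%O by rewrite inE in yz.
have yx : (val y <= x)%O := le_trans yzle zx.
have zy : supp z = supp (val y) :|: supp z' by rewrite supp_vertex z's setD1K.
have yz0 : supp (val y) :&: supp z' = set0.
  by rewrite supp_vertex z's; apply/setP => u; rewrite !inE; case: eqP.
rewrite (face_mon_mul zx yx z'x zy yz0) face_mon_vertex //.
have IHz' : sp_prime x (t z' - face_mon z').
  apply: IH => //; rewrite z's.
  by move: zk; rewrite (cardsD1 y (supp z)) yz add1n ltnS.
rewrite (_ : _ - _ = (t z - t (val y) * t z') + t (val y) * (t z' - face_mon z')); last first.
  by rewrite mulrBr addrA subrK.
apply: is_idealD => //; last exact: is_idealM.
have [z'0|z'0] := eqVneq z' \bot%O.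
  have -> : z = val y.
    by apply: (supp_inj simpP zx yx); rewrite zy z'0 supp_bot setU0.
  by rewrite z'0 tvar_bot mulr1 subrr; exact: is_ideal0.
have [j [jx js jE]] := joins_supp simpP yx z'x.
have jz : j = z by apply: (supp_inj simpP jx zx); rewrite js zy.
have [mx ms] := pmeet_supp simpP yx z'x.
have m0 : pmeet (val y) z' = \bot%O.
  by apply: (supp_inj simpP mx) => //; rewrite ms yz0 supp_bot.
pose yy : pstar P := Sub (val y) (vertex_neq_bot y); pose zz : pstar P := Sub z' z'0.
have zj : z \in joins (val y) z'.
  by have := jE z; rewrite -jz eqxx jz => /andP[].
have fE : frel_poly K yy zz = t (val y) * t z' - t z -
    \sum_(u in joins (val y) z' | u != z) t u.
  by rewrite /frel_poly /= m0 tvar_bot mul1r (bigD1 z) //= opprD addrA.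
rewrite (_ : t z - _ = - 1 * (frel_poly K yy zz +
    \sum_(u in joins (val y) z' | u != z) t u)); last by rewrite fE subrK mulN1r opprB.
apply: is_idealM => //; apply: is_idealD => //.
  exists 0, (frel_poly K yy zz); split; last by rewrite add0r.
    exact: is_ideal0 (ideal_gen_is_ideal _).
  by apply: ideal_gen_gen; exists yy, zz.
apply: is_ideal_sum => // u /andP[uj uz]; apply: above; apply: contra uz => ux.
by have := jE u; rewrite uj ux jz.
Qed.

(** Below x, only the join of a and b in the Boolean algebra contributes to the
    sum, and the relation becomes inclusion-exclusion for sets of vertices. *)
Lemma face_subst_frel (a b : pstar P) : subst face_subst (frel_poly K a b) = 0.
Proof.
rewrite rmorphB !rmorphM rmorph_sum /= !face_subst_tvar.
rewrite (eq_bigr _ (fun z _ => face_subst_tvar z)).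
have [/andP[ax bx]|nab] := boolP ((val a <= x) && (val b <= x))%O; last first.
  have -> : face_mon (val a) * face_mon (val b) = 0.
    by move: nab; rewrite /face_mon; case: (_ <= x)%O; case: (_ <= x)%O => //;
      rewrite ?mul0r ?mulr0.
  rewrite big1 ?mulr0 ?subrr // => z; rewrite inE => /and3P[az bz _].
  rewrite /face_mon ifN //; apply: contra nab => zx.
  by rewrite (le_trans az zx) (le_trans bz zx).
have [j [jx js jE]] := joins_supp simpP ax bx.
have [mx ms] := pmeet_supp simpP ax bx.
have jj : j \in joins (val a) (val b) by have := jE j; rewrite eqxx => /andP[].
rewrite (bigD1 j) //= big1 ?addr0; last first.
  move=> u /andP[uj ne]; rewrite /face_mon ifN //; apply: contra ne => ux.
  by rewrite -jE uj.
apply/eqP; rewrite subr_eq0; apply/eqP.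
rewrite /face_mon ax bx mx jx ms js.
rewrite [X in _ = _ * X](big_setID (supp (val a))) /= setUK setDUl setDv set0U.
rewrite [X in _ * X = _](big_setID (supp (val a))) /= setIC.
by rewrite mulrCA.
Qed.

(** Modulo p_x every variable equals its image, so f equals the image of f. *)
Lemma sp_primeP (f : S) : sp_prime x f <-> subst face_subst f = 0.
Proof.
split.
  case=> g [h [[k [c [g' [hg ->]]]] [k' [c' [h' [hh ->]]]] ->]].
  rewrite rmorphD !rmorph_sum /= !big1 ?addr0 // => i _; rewrite rmorphM /=.
    by have [a [b ->]] := hh i; rewrite face_subst_frel mulr0.
  have [z zx ->] := hg i.
  by rewrite face_subst_tvar /face_mon (negPf zx) mulr0.
move=> f0; rewrite -[f]subr0 -[X in _ - X]f0 -[X in X - _]subst_id.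
apply: (rmorph_congr sp_prime_is_ideal (f := subst (fun i => 'X_i))
   (g := subst face_subst)) => [c|i] /=; first by rewrite !substC.
by rewrite !substX -tvar_elt; exact: tvar_face_mon.
Qed.

End FacePrime.

(** * The chain of graded primes ending at p_x, and its length *)

Section GradedSubst.
Context {d : Order.disp_t} (P : finBPOrderType d) (K : fieldType).
Local Notation S := {mpoly K[nvars P]}.

Lemma phomogX i : phomog (degt (elt i)) ('X_i : S).
Proof.
move=> m; rewrite msuppX inE => /eqP->.
rewrite /mondeg (bigD1 i) //= mnm1E eqxx mulr1n big1 ?addr0 // => j ji.
by rewrite mnm1E eq_sym (negPf ji).
Qed.

Lemma phomog_prod (J : Type) (r : seq J) (Q : pred J) (a : J -> Zn P) (F : J -> S) :
  (forall j, Q j -> phomog (a j) (F j)) ->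
  phomog (\sum_(j <- r | Q j) a j) (\prod_(j <- r | Q j) F j).
Proof.
move=> h; apply: (big_ind2 (fun a f => phomog a f)) => //; first exact: phomog1.
by move=> *; exact: phomogM.
Qed.

Lemma phomogXn a (f : S) e : phomog a f -> phomog (a *+ e) (f ^+ e).
Proof.
move=> hf; elim: e => [|e IH]; first exact: phomog1.
by rewrite exprS mulrS; exact: phomogM.
Qed.

Section Hom.
Variable h : 'I_(nvars P) -> S.
Hypothesis h_homog : forall i, phomog (degt (elt i)) (h i).

Lemma subst_homog a (f : S) : phomog a f -> phomog a (subst h f).
Proof.
move=> hf; rewrite /subst comp_mpolyE big_seq.
apply: (@gpart_bigsum _ _ _ (greg P K)) => m /hf <-.
move=> m' /msuppZ_le; apply: phomog_prod => i _.
by rewrite tnth_mktuple; apply: phomogXn; exact: h_homog.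
Qed.

Fact kernel_graded : graded_submodule (M := greg P K)
  (fun f => f \in (kernel_prime (subst h) : {pred S})).
Proof.
split.
  split=> [|s u v hu hv]; first exact: rpred0.
  by apply: rpredD => //; exact: idealMr.
move=> u /kernelP u0.
have hadd : zmod_morphism (subst h : greg P K -> greg P K) by exact: rmorphB.
have deg0 c (v : greg P K) : gpart (greg P K) c v ->
    gpart (greg P K) (0 + c) (mk_additive hadd v).
  by move=> hv; rewrite add0r; exact: subst_homog.
have [k [c [g [hg ->]]]] := ker_decomp deg0 u0.
exists k, c, g; split=> // j; have [hj kj] := hg j; split=> //.
by apply/kernelP.
Qed.

Definition kernel_gprime : gprime P K := GPrime kernel_graded.
End Hom.
End GradedSubst.

Section Elimination.
Context {d : Order.disp_t} (P : finBPOrderType d) (K : fieldType).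
Hypothesis simpP : simplicial P.
Variable x : P.
Local Notation S := {mpoly K[nvars P]}.
Local Notation h := (face_subst K x).

Definition is_face_var : pred 'I_(nvars P) :=
  fun i => (elt i <= x)%O && has_rank (elt i) 1.

Definition eliminated : seq 'I_(nvars P) := [seq i <- enum 'I_(nvars P) | ~~ is_face_var i].
Local Notation e := eliminated.

Lemma eliminated_uniq : uniq e. Proof. by rewrite filter_uniq ?enum_uniq. Qed.

Lemma mem_eliminated i : (i \in e) = ~~ is_face_var i.
Proof. by rewrite mem_filter mem_enum andbT. Qed.

Lemma vertex_index (y : vertex P) : (val y <= x)%O ->
  exists2 i, is_face_var i & @tvar d P K (val y) = 'X_i.
Proof.
move=> yx; have [i yi ti] := tvarE K (vertex_neq_bot y).
by exists i => //; rewrite /is_face_var -yi yx; exact: valP y.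
Qed.

Lemma face_subst_var i : is_face_var i -> h i = 'X_i.
Proof.
case/andP=> ix i1; pose y : vertex P := Sub (elt i) i1.
by rewrite /face_subst -[elt i]/(val y) face_mon_vertex // SubK tvar_elt.
Qed.

Lemma face_subst_fixed (h' : 'I_(nvars P) -> S) :
  (forall i, is_face_var i -> h' i = 'X_i) -> forall i, subst h' (h i) = h i.
Proof.
move=> h'X i; rewrite /face_subst /face_mon; case: ifP => [ix|_]; last exact: rmorph0.
rewrite rmorph_prod; apply: eq_bigr => y; rewrite inE => yi /=.
by have [j gj ->] := vertex_index (le_trans yi ix); rewrite substX h'X.
Qed.

Lemma degt_supp (z : P) : degt z = \sum_(y in supp z) degt (val y).
Proof.
apply/ffunP => y; rewrite sum_ffunE !ffunE.
have E (u : vertex P) : (val y <= val u)%O = (u == y).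
  by have := supp_vertex u => /setP/(_ y); rewrite !inE eq_sym.
have [yz|yz] := boolP (val y <= z)%O.
  rewrite (bigD1 y) ?inE //= ffunE E eqxx big1 ?addr0 // => u /andP[_ uy].
  by rewrite ffunE E (negPf uy).
rewrite big1 // => u; rewrite inE ffunE E => uz.
by case: eqP => // uy; rewrite -uy uz in yz.
Qed.

Lemma face_subst_homog i : phomog (degt (elt i)) (h i).
Proof.
rewrite /face_subst /face_mon; case: ifP => _; last exact: phomog0.
rewrite degt_supp; apply: phomog_prod => y _.
have [j -> ->] := tvarE K (vertex_neq_bot y); exact: phomogX.
Qed.

Lemma partial_subst_homog k i : phomog (degt (elt i)) (partial_subst h e k i).
Proof.
by rewrite /partial_subst; case: ifP => _; [exact: face_subst_homog | exact: phomogX].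
Qed.

Definition elim_prime k : gprime P K := kernel_gprime (@partial_subst_homog k).

Lemma elim_primeP k (s : S) : reflect (subst (partial_subst h e k) s = 0)
  (s \in (gprime_ideal (elim_prime k) : {pred S})).
Proof. exact: eqP. Qed.

(** [nth] with a default in S (and in Z^n below) avoids choosing a default variable,
    of which there may be none. *)
Definition elim_rel k : S := nth 0 [seq 'X_i - h i | i <- e] k.
Definition elim_deg k : Zn P := nth 0 [seq degt (elt i) | i <- e] k.

Lemma face_subst_fixed_elim (h' : 'I_(nvars P) -> S) : (forall i, i \notin e -> h' i = 'X_i) ->
  forall i, i \in e -> subst h' (h i) = h i.
Proof.
by move=> h'X i _; apply: face_subst_fixed => j gj; apply: h'X; rewrite mem_eliminated gj.
Qed.

Lemma elim_relE k : (k < size e)%N -> exists i0,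
  elim_rel k = subst_rel h e k i0 /\ elim_deg k = degt (elt (nth i0 e k)).
Proof.
move=> ke; have [i0 _] : exists i : 'I_(nvars P), true.
  by case: (e) ke => // i s _; exists i.
by exists i0; rewrite /elim_rel /elim_deg !(nth_map i0).
Qed.

Lemma elim_prime0 s : s \in (gprime_ideal (elim_prime 0) : {pred S}) -> s = 0.
Proof. by move/elim_primeP; rewrite partial_subst0. Qed.

Lemma elim_rel_homog k : (k < size e)%N -> phomog (elim_deg k) (elim_rel k).
Proof.
case/elim_relE=> i0 [-> ->]; apply: phomogB; first exact: phomogX.
exact: face_subst_homog.
Qed.

Lemma elim_rel_notin k : (k < size e)%N ->
  elim_rel k \notin (gprime_ideal (elim_prime k) : {pred S}).
Proof.
move=> ke; have [i0 [-> _]] := elim_relE ke; apply/elim_primeP.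
rewrite (partial_subst_rel eliminated_uniq face_subst_fixed_elim) //; apply/eqP.
exact: (subst_rel_neq0 face_subst_fixed_elim).
Qed.

Lemma elim_rel_in k : (k < size e)%N ->
  elim_rel k \in (gprime_ideal (elim_prime k.+1) : {pred S}).
Proof.
move=> ke; have [i0 [-> _]] := elim_relE ke; apply/elim_primeP.
exact: (partial_substS_rel face_subst_fixed_elim).
Qed.

Lemma elim_primeS k : (k < size e)%N -> forall s,
  s \in (gprime_ideal (elim_prime k) : {pred S}) ->
  s \in (gprime_ideal (elim_prime k.+1) : {pred S}).
Proof.
move=> ke s /elim_primeP s0; apply/elim_primeP; have [i0 _] := elim_relE ke.
exact: (partial_subst_kerS eliminated_uniq face_subst_fixed_elim i0).
Qed.

Lemma elim_primeE k : (k < size e)%N -> forall s,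
  s \in (gprime_ideal (elim_prime k.+1) : {pred S}) ->
  exists s0 g, s0 \in (gprime_ideal (elim_prime k) : {pred S}) /\ s = s0 + elim_rel k * g.
Proof.
move=> ke s /elim_primeP s0; have [i0 [-> _]] := elim_relE ke.
have [s1 [g [h1 ->]]] := partial_subst_kerE eliminated_uniq face_subst_fixed_elim i0 ke s0.
by exists s1, g; split=> //; apply/elim_primeP.
Qed.

Lemma partial_subst_top : partial_subst h e (size e) =1 h.
Proof.
move=> i; rewrite /partial_subst take_size mem_eliminated; case: ifP => // /negbFE gi.
by rewrite face_subst_var.
Qed.

Lemma elim_prime_top s : s \in (gprime_ideal (elim_prime (size e)) : {pred S}) <-> sp_prime x s.
Proof.
rewrite sp_primeP // -(eq_subst partial_subst_top).
by split=> [/elim_primeP|] //; move/elim_primeP.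
Qed.

Definition face_vars : {set 'I_(nvars P)} := [set i | is_face_var i].

Lemma size_eliminated : (size e + #|face_vars|)%N = nvars P.
Proof.
rewrite -(card_uniqP eliminated_uniq) -[RHS]card_ord -(cardC (mem e)).
by congr addn; apply: eq_card => i; rewrite !inE mem_eliminated negbK.
Qed.

(** The elimination chain reaches the bound of [chain_bound], since the vertices
    below x are fixed by the substitution, hence algebraically independent modulo
    p_x. *)
Lemma face_prime_height (px : gprime P K) :
  (forall f, f \in (gprime_ideal px : {pred S}) <-> sp_prime x f) ->
  has_height px (size e).
Proof.
move=> pxE; split.
  exists (fun k => gprime_ideal (elim_prime k)); split.
    by move=> s; apply/idP/idP => [/elim_prime_top/pxE|/pxE/elim_prime_top].
  move=> j je; split=> [s|sub]; first exact: elim_primeS.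
  by have := sub _ (elim_rel_in je); apply/negP; exact: elim_rel_notin.
move=> k [c [ck cs]].
rewrite -(leq_add2r #|face_vars|) size_eliminated.
apply: (chain_bound (p := px) _ ck cs) => F FA /pxE /sp_primeP F0.
rewrite -FA -[RHS](F0 simpP) -{2}FA subst_comp; apply: eq_subst => i /=.
rewrite inE; case: ifP => gi; last by rewrite rmorph0.
by rewrite substX face_subst_var.
Qed.

Definition face_vars_mon : S := \prod_(i in face_vars) 'X_i.

Lemma face_vars_mon_notin : face_vars_mon \notin (gprime_ideal (elim_prime (size e)) : {pred S}).
Proof.
apply/elim_primeP; rewrite (eq_subst partial_subst_top) rmorph_prod /=; apply/eqP.
apply/prodf_neq0 => i; rewrite inE => gi; rewrite substX face_subst_var //.
by rewrite -msize_poly_eq0 msizeX.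
Qed.

(** The weight is the sum of the degrees of all variables, so that removing the
    degrees of the eliminated ones leaves those of the vertices below x. *)
Lemma face_vars_mon_homog :
  phomog (cycle_deg (weight P) elim_deg (size e)) face_vars_mon.
Proof.
rewrite (_ : cycle_deg _ _ _ = \sum_(i in face_vars) degt (elt i)).
  by apply: phomog_prod => i _; exact: phomogX.
have -> : weight P = \sum_i degt (elt i).
  rewrite /weight (reindex (fun i : 'I_(nvars P) => enum_val i : pstar P)) //.
  exact: onW_bij (@enum_val_bij (pstar P)).
rewrite /cycle_deg.
have -> : \sum_(k < size e) elim_deg k = \sum_(i | ~~ is_face_var i) degt (elt i).
  transitivity (\sum_(b <- [seq degt (elt i) | i <- e]) b).
    by rewrite (big_nth 0) size_map big_mkord.
  by rewrite big_map big_filter big_enum_cond.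
rewrite (bigID is_face_var) /= addrK; apply: eq_bigl => i.
by rewrite inE.
Qed.

End Elimination.

(** * The shift at p_x *)

Theorem proposition4p3 (d : Order.disp_t) (P : finBPOrderType d) (K : fieldType)
  (simpP : simplicial P)
  (D : int -> gmod P K) (diff : forall j : int, ghom (D j) (D (j + 1)))
  (aug : ghom (shift (greg P K) (- weight P)) (D (- (nvars P)%:Z)))
  (Dmin : minimal_injective_resolution diff aug)
  (E : gprime P K -> gmod P K) (env : forall p : gprime P K, ghom (gquot p) (E p))
  (Eenv : forall p : gprime P K, injective_envelope (env p))
  (a : gprime P K -> Zn P)
  (Ddec : forall i : nat, (i <= nvars P)%N ->
     is_direct_sum
       (fun p : {p : gprime P K | has_height p (nvars P - i)} =>
          shift (E (sval p)) (- a (sval p)))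
       (D (- i%:Z))) :
  forall (x : P) (px : gprime P K),
    (forall f, f \in (gprime_ideal px : {pred _}) <-> sp_prime x f) ->
    giso (shift (E px) (- a px)) (E px).
Proof.
move=> x px pxE; have [injD _ [aug_inj aug_exact] exactD essD] := Dmin.
pose N := nvars P; pose m := size (eliminated x).
(* Iterating the successor makes [D (deg n.+1)] convertible to the target of
   [diff (deg n)]. *)
pose deg n : int := iter n (fun j => j + 1) (- N%:Z).
have degE n : deg n = n%:Z - N%:Z.
  by elim: n => [|n IH]; rewrite ?sub0r // /deg iterS -/(deg n) IH -addn1 PoszD addrAC.
have mN : (m <= N)%N by rewrite -[X in (_ <= X)%N](size_eliminated x) leq_addr.
have hpx : has_height px (N - (N - m)) by rewrite subKn //; exact: face_prime_height.
have := Ddec _ (leq_subr m N); rewrite -/N.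
have -> : - (N - m)%N%:Z = deg m by rewrite degE -subzn // opprB.
case=> u [u_inj _].
pose one : gquot px := \pi_({ideal_quot (gprime_ideal px)}) (1 : {mpoly K[N]}).
pose v := u (exist _ px hpx) (env px one).
have [injE env_inj _] := Eenv px.
have v_part : gpart (D (deg m)) (a px) v.
  apply: (gfun_deg (u (exist _ px hpx))); rewrite /= /shift_part addNr.
  by apply: gfun_deg; apply: cl_part; exact: phomog1.
have v_neq0 : v <> 0.
  rewrite -(raddf0 (u (exist _ px hpx))) => /u_inj.
  rewrite -[RHS](raddf0 (env px)) => /env_inj /cl_eq0.
  by rewrite idealr1.
have top_px s : s \in (gprime_ideal (elim_prime K x m) : {pred _}) <->
    s \in (gprime_ideal px : {pred _}) by rewrite elim_prime_top // pxE.
have v_killed : killed (elim_prime K x m) v.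
  move=> q /top_px hq; rewrite -linearZ /=.
  have -> : q *: (env px one : shift (E px) (- a px)) = 0.
    by rewrite -[LHS]/(q *: env px one) -linearZ /= quot_killed // raddf0.
  exact: raddf0.
pose e1 : shift (greg P K) (- weight P) := (1 : {mpoly K[N]}).
have sE (s : shift (greg P K) (- weight P)) : s = (s : {mpoly K[N]}) *: e1.
  exact: esym (mulr1 (s : {mpoly K[N]})).
have exact_deg n (y : D (deg n.+1)) :
    diff (deg n.+1) y = 0 <-> exists y', diff (deg n) y' = y.
  apply: (exactD (deg n)).
  by rewrite degE -subr_eq0 opprK addrAC subrK -PoszD addn1.
have z0_part : gpart (D (deg 0)) (weight P) (aug e1).
  by apply: (gfun_deg aug); rewrite /= /shift_part addNr; exact: phomog1.
have z0_cycles (y : D (deg 0)) :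
    diff (deg 0) y = 0 <-> exists s : {mpoly K[N]}, y = s *: aug e1.
  by rewrite aug_exact; split=> [[s <-]|[s ->]]; exists s; rewrite -?linearZ -?sE.
have z0_free (s : {mpoly K[N]}) : s *: aug e1 = 0 -> s = 0.
  by rewrite -linearZ -[RHS](raddf0 aug) -(sE s) => /aug_inj.
have [c [s [g [hs sp hg gp]]]] := killed_degree
  (C := fun n => D (deg n)) (del := fun n => diff (deg n))
  (fun n => injD (deg n)) exact_deg (fun n => essD (deg n)) z0_part z0_cycles z0_free
  (@elim_prime0 _ _ _ x) (@elim_rel_homog _ _ K x) (@elim_rel_notin _ _ K x)
  (@elim_rel_in _ _ K x) (@elim_primeS _ _ K x) (@elim_primeE _ _ K x) v_part v_neq0 v_killed.
apply: (envelope_shift (Eenv px) (c := c) (s1 := g * face_vars_mon K x) (s2 := s)) => //.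
- rewrite -[c + _](subrK (cycle_deg (weight P) (elim_deg x) m)); apply: phomogM => //.
  exact: face_vars_mon_homog.
- apply/negP => /top_px; rewrite prime_idealrM (negPf gp) /=.
  by apply/negP; exact: face_vars_mon_notin.
- by apply/negP => /top_px; apply/negP.
Qed.
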